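(* Under the standing assumptions below, for every $\gamma\in\mathbb R^I_+$, $x_0\in\mathcal X$, $s_0\in\mathcal S$, the maximum value of the ex-post lottery problem for $(\gamma,x_0,s_0)$ equals $\tilde D(\gamma,x_0,s_0)$. Moreover, $\tilde D$ is the largest solution in $\mathcal N$ of the functional equation $F(\gamma,x,s)=\sup_{a\in\tilde{\mathcal A}(x,s)}\inf_{\lambda\in\mathbb R^I_+}\big[r(x,a,s)+\sum_i(\gamma^ig^i(x,a,s)+\lambda^i(g^i(x,a,s)-\bar g^i))+\beta\mathbb E_sF(\gamma+\lambda,\zeta(x,a,s),s')\big]$.
   Context: Setup. Let $\mathcal S$ be a finite set and $(s_t)_{t\ge0}$ a Markov chain on $\mathcal S$ with transition probabilities $\pi(s'|s)>0$ for all $s,s'$; for $s^t=(s_0,\dots,s_t)$ write $\pi^t(s^t|s_0)$ for its probability and $\mathbb E_{s^t}$ (or $\mathbb E_{s_t}$) for expectation over future shocks given $s^t$; $\mathbb E_s$ denotes expectation over $s'\sim\pi(\cdot|s)$. Let $\mathcal A\subset\mathbb R^n$ be finite, $\mathcal X\subseteq\mathbb R^m$ countable, $\zeta:\mathcal X\times\mathcal A\times\mathcal S\to\mathcal X$, $p:\mathcal X\times\mathcal A\times\mathcal S\to\mathbb R$, $r,g^1,\dots,g^I$ bounded real functions on $\mathcal X\times\mathcal A\times\mathcal S$, $\bar g^i\in\mathbb R$, $\beta\in(0,1)$. A plan is $a=(a(s^t))_{t,s^t}$, $a(s^t)\in\mathcal A$, inducing $x(s^0)=x_0$, $x(s^{t+1})=\zeta(x(s^t),a(s^t),s_t)$.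 $\tilde{\mathcal A}(x,s)=\{a:p(x,a,s)\ge0\}$; $\tilde{\mathcal A}^\infty(x_0)$ is the set of plans with $a(s^t)\in\tilde{\mathcal A}(x(s^t),s_t)$ for all $t,s^t$. A plan is feasible for $(x_0,s_0)$ if it lies in $\tilde{\mathcal A}^\infty(x_0)$ and $\mathbb E_{s_t}\sum_{n\ge0}\beta^ng^i(x(s^{t+n}),a(s^{t+n}),s_{t+n})\ge\bar g^i$ for all $t,s^t,i$. Standing assumption: for every $(x_0,s_0)$ a feasible plan exists. $\tilde D$: post-action histories $\tilde h^t=(s_0,a_0,\dots,s_t,a_t)\in\tilde{\mathcal H}^t=\mathcal S^{t+1}\times\mathcal A^{t+1}$; a plan generates $\tilde h^t=(s_0,a(s^0),\dots,s_t,a(s^t))$. $\tilde\Lambda$: families $\lambda^i(\tilde h^t)\ge0$ with $\sum_t\sum_{\tilde h^t}\sum_i\beta^t\lambda^i(\tilde h^t)\pi^t(s^t|s_0)<\infty$. $\tilde L(a,\lambda;\gamma,x_0,s_0)=\mathbb E_{s_0}\sum_t\beta^t\big[r(x(s^t),a(s^t),s_t)+\sum_i\gamma^ig^i(x(s^t),a(s^t),s_t)+\sum_i\lambda^i(\tilde h^t)(\sum_{n\ge0}\beta^ng^i(x(s^{t+n}),a(s^{t+n}),s_{t+n})-\bar g^i)\big]$ and $\tilde D(\gamma,x_0,s_0)=\inf_{\lambda\in\tilde\Lambda}\sup_{a\in\tilde{\mathcal A}^\infty(x_0)}\tilde L$. Ex-post lottery problem. Give $\tilde{\mathcal A}^\infty(x_0)$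 the product topology, let $\mathcal P(\tilde{\mathcal A}^\infty(x_0))$ be its Borel probability measures, random plans $a\sim P$ independent of shocks. Maximize $\mathbb E^{a\sim P}_{s_0}\sum_t\beta^t\big(r(x(s^t),a(s^t),s_t)+\sum_i\gamma^ig^i(x(s^t),a(s^t),s_t)\big)$ over $P$ subject to: for all $t$, all $\tilde h^t=(s_0,\tilde a_0,\dots,s_t,\tilde a_t)\in\tilde{\mathcal H}^t$ and all $i$, $\mathbb E^{a\sim P}_{s^t}\big[\mathbf 1\{(a(s^0),\dots,a(s^t))=(\tilde a_0,\dots,\tilde a_t)\}(\sum_{n\ge0}\beta^ng^i(x(s^{t+n}),a(s^{t+n}),s_{t+n})-\bar g^i)\big]\ge0$, with $s^t$ the shock history in $\tilde h^t$. Function spaces. $L=(\|r\|_\infty+\sum_i\|g^i\|_\infty)/(1-\beta)$, $B(k)=\{\gamma\in\mathbb R^I_+:\|\gamma\|_\infty\le k\}$, $\mathcal S=\{s_1,\dots,s_{|\mathcal S|}\}$, $\mathcal X=\{x_1,x_2,\dots\}$. $\mathcal M$: functions $F:\mathbb R^I_+\times\mathcal X\times\mathcal S\to\mathbb R$ with $F(\cdot,x,s)\in L^\infty(B(k))$ for all $k$ and $\|F\|_{\mathcal M}=\sum_i2^{-i}\sum_j2^{-j}\sum_{k\ge1}2^{-k}\|F(\cdot,x_j,s_i)\|_{L^\infty(B(k))}<\infty$. $\mathcal N$: those $F\in\mathcal M$ with, for all $x,s$, (i) $F(\cdot,x,s)$ convex; (ii) $|F(\gamma_1,x,s)-F(\gamma_2,x,s)|\le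 L\|\gamma_1-\gamma_2\|_1$; (iii) $F(\gamma,x,s)\ge v^0+\sum_i\gamma^iv^i$ for every feasible plan for $(x,s)$, $v^0=\mathbb E_s\sum_t\beta^tr(\cdot)$, $v^i=\mathbb E_s\sum_t\beta^tg^i(\cdot)$; (iv) $F(\gamma,x,s)\le(1+\sum_i\gamma^i)L$. *)

(* Defs.v *)
From HB Require Import structures.
From mathcomp Require Import all_boot all_order all_algebra.
From mathcomp Require Import all_classical all_reals all_analysis.
Set Implicit Arguments. Unset Strict Implicit. Unset Printing Implicit Defensive.
Import Order.TTheory GRing.Theory Num.Theory.
Local Open Scope classical_set_scope.
Local Open Scope ring_scope.

Record model (R : realType) := Model {
  St : finType;
  Ac : finType;
  Xs : countType;
  nI : nat;
  trans_ : St -> St -> R;                    (* trans_ s s' = trans_(s'|s)                *)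
  zeta_ : Xs -> Ac -> St -> Xs;
  pfun : Xs -> Ac -> St -> R;
  rfun : Xs -> Ac -> St -> R;
  gfun : 'I_nI -> Xs -> Ac -> St -> R;
  gbar_ : 'I_nI -> R;
  beta_ : R;
  a_pt : Ac                              (* witness that A is nonempty *) }.
Arguments trans_ {R} m _ _.
Arguments zeta_ {R m} _ _ _.
Arguments pfun {R} m _ _ _.
Arguments rfun {R} m _ _ _.
Arguments gfun {R} m _ _ _ _.
Arguments gbar_ {R} m _.
Arguments beta_ {R} m.
Arguments a_pt {R} m.

Section Defs.
Variables (R : realType) (M : model R).
Local Notation S := (St M).
Local Notation A := (Ac M).
Local Notation X := (Xs M).
Local Notation I := (nI M).

Definition bdd3 (f : X -> A -> S -> R) := exists C : R, forall x a s, `|f x a s| <= C.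

Definition rser (u : nat -> R) : R := limn (fun n => \sum_(k < n) u k).

(* A plan assigns an action to each shock history s^t = (s_0, [s_1;...;s_t]). *)
Definition plan := (S * seq S)%type -> A.
HB.instance Definition _ := Choice.on plan.
HB.instance Definition _ := isPointed.Build plan (fun _ => a_pt M).

Fixpoint state_aux (a : plan) (s0 : S) (pre : seq S) (x : X) (rest : seq S) : X :=
  match rest with
  | [::] => x
  | s :: rest' => state_aux a s0 (rcons pre s) (@zeta_ R M x (a (s0, pre)) (last s0 pre)) rest'
  end.
Definition state (a : plan) (x0 : X) (s0 : S) (w : seq S) : X := state_aux a s0 [::] x0 w.

Definition fval (f : X -> A -> S -> R) (a : plan) x0 s0 (w : seq S) : R :=
  f (state a x0 s0 w) (a (s0, w)) (last s0 w).

Fixpoint pprob (s : S) (w : seq S) : R :=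
  match w with [::] => 1 | s' :: w' => trans_ M s s' * pprob s' w' end.

Definition Eh (s0 : S) (t : nat) (h : seq S -> R) : R :=
  \sum_(w : t.-tuple S) pprob s0 w * h w.

Definition value (f : X -> A -> S -> R) (a : plan) x0 s0 : R :=
  rser (fun t => beta_ M ^+ t * Eh s0 t (fval f a x0 s0)).

Definition cont (f : X -> A -> S -> R) (a : plan) x0 s0 (w : seq S) : R :=
  rser (fun n => beta_ M ^+ n *
    \sum_(w' : n.-tuple S) pprob (last s0 w) w' * fval f a x0 s0 (w ++ w')).

Definition admissible x0 s0 (a : plan) : Prop :=
  forall w : seq S, 0 <= pfun M (state a x0 s0 w) (a (s0, w)) (last s0 w).

Definition feasible x0 s0 (a : plan) : Prop :=
  admissible x0 s0 a /\ forall (w : seq S) (i : 'I_I), gbar_ M i <= cont (gfun M i) a x0 s0 w.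

Definition posthist (a : plan) s0 (w : seq S) : seq (S * A) :=
  [seq (nth s0 (s0 :: w) k, a (s0, take k w)) | k <- iota 0 (size w).+1].
Definition actions (a : plan) s0 (w : seq S) : seq A :=
  [seq a (s0, take k w) | k <- iota 0 (size w).+1].

Definition pit (s0 : S) (sh : seq S) : R :=
  match sh with [::] => 0 | s :: w => (s == s0)%:R * pprob s0 w end.

Definition nonneg (g : 'I_I -> R) := forall i, 0 <= g i.

Definition in_Lam s0 (lam : seq (S * A) -> 'I_I -> R) : Prop :=
  (forall h i, 0 <= lam h i) /\
  cvgn (fun n => \sum_(t < n) (beta_ M ^+ t *
     \sum_(h : t.+1.-tuple (S * A)) \sum_(i < I) lam h i * pit s0 [seq hh.1 | hh <- h])).

Definition rg (gam : 'I_I -> R) (x : X) (a : A) (s : S) : R :=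
  rfun M x a s + \sum_(i < I) gam i * gfun M i x a s.

Definition Lag gam x0 s0 (a : plan) (lam : seq (S * A) -> 'I_I -> R) : R :=
  rser (fun t => beta_ M ^+ t * Eh s0 t (fun w =>
     fval (rg gam) a x0 s0 w +
     \sum_(i < I) lam (posthist a s0 w) i * (cont (gfun M i) a x0 s0 w - gbar_ M i))).

Definition Dt gam x0 s0 : \bar R :=
  ereal_inf [set ereal_sup [set (Lag gam x0 s0 a lam)%:E | a in [set a | admissible x0 s0 a]]
            | lam in [set lam | in_Lam s0 lam]].

(* Ex-post lottery: the sigma-algebra on plans generated by cylinder sets
   (= Borel sigma-algebra of the product topology, A finite, histories countable). *)
Definition cyl : set (set plan) := [set C | exists h b, C = [set a : plan | a h = b]].
Local Notation PlanM := (g_sigma_algebraType cyl).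

Definition lot_obj gam x0 s0 (P : probability PlanM R) : \bar R :=
  (\int[P]_(a in setT) (value (rg gam) a x0 s0)%:E)%E.

Definition lot_feas x0 s0 (P : probability PlanM R) : Prop :=
  P [set a : PlanM | admissible x0 s0 a] = 1%E /\
  forall (t : nat) (w : t.-tuple S) (at_ : t.+1.-tuple A) (i : 'I_I),
    (0 <= \int[P]_(a in setT)
       (((actions a s0 w == tval at_)%:R * (cont (gfun M i) a x0 s0 w - gbar_ M i))%:E))%E.

Definition lottery_max gam x0 s0 (v : \bar R) : Prop :=
  (exists P, lot_feas x0 s0 P /\ lot_obj gam x0 s0 P = v) /\
  (forall P, lot_feas x0 s0 P -> (lot_obj gam x0 s0 P <= v)%E).

Definition supn (f : X -> A -> S -> R) : R :=
  fine (ereal_sup (range (fun xas : X * A * S => (`|f xas.1.1 xas.1.2 xas.2|)%:E))).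
Definition Lconst : R :=
  (supn (rfun M) + \sum_(i < I) supn (gfun M i)) / (1 - beta_ M).

Definition Bk (k : nat) := [set g : 'I_I -> R | nonneg g /\ forall i, g i <= k%:R].
Definition supB (F : ('I_I -> R) -> X -> S -> R) x s k : \bar R :=
  ereal_sup [set (`|F g x s|)%:E | g in Bk k].

Definition normM (F : ('I_I -> R) -> X -> S -> R) : \bar R :=
  (\sum_(s : S) ((2:R) ^- (enum_rank s).+1)%:E *
    \esum_(x in [set: X]) (((2:R) ^- (pickle x).+1)%:E *
      \sum_(k <oo) (((2:R) ^- k.+1)%:E * supB F x s k.+1)))%E.

Definition inM F : Prop :=
  (forall x s k, (0 < k)%N -> (supB F x s k < +oo)%E) /\ (normM F < +oo)%E.

Definition inN (F : ('I_I -> R) -> X -> S -> R) : Prop :=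
  inM F /\
  (forall x s g1 g2 (t : R), nonneg g1 -> nonneg g2 -> 0 <= t <= 1 ->
     F (fun i => t * g1 i + (1 - t) * g2 i) x s <= t * F g1 x s + (1 - t) * F g2 x s) /\
  (forall x s g1 g2, nonneg g1 -> nonneg g2 ->
     `|F g1 x s - F g2 x s| <= Lconst * \sum_(i < I) `|g1 i - g2 i|) /\
  (forall x s g (a : plan), nonneg g -> feasible x s a ->
     value (rfun M) a x s + \sum_(i < I) g i * value (gfun M i) a x s <= F g x s) /\
  (forall x s g, nonneg g -> F g x s <= (1 + \sum_(i < I) g i) * Lconst).

Definition bellman_rhs (F : ('I_I -> R) -> X -> S -> R) g x s (a : A) (lam : 'I_I -> R) : R :=
  rfun M x a s + \sum_(i < I) (g i * gfun M i x a s + lam i * (gfun M i x a s - gbar_ M i))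
  + beta_ M * \sum_(s' : S) trans_ M s s' * F (fun i => g i + lam i) (zeta_ x a s) s'.

Definition bellman (F : ('I_I -> R) -> X -> S -> R) : Prop :=
  forall g x s, nonneg g ->
    (F g x s)%:E =
    ereal_sup [set ereal_inf [set (bellman_rhs F g x s a lam)%:E | lam in [set l | nonneg l]]
              | a in [set a | 0 <= pfun M x a s]].

End Defs.

(* Main.v *)
Require Import Defs.
From HB Require Import structures.
From mathcomp Require Import all_boot all_order all_algebra.
From mathcomp Require Import all_classical all_reals all_analysis.
From mathcomp Require Import measurable_realfun.
From mathcomp Require Import ring lra.
Import Order.TTheory GRing.Theory Num.Theory.
Import numFieldNormedType.Exports.
Local Open Scope classical_set_scope.
Local Open Scope ring_scope.
Set Implicit Arguments.
Unset Strict Implicit.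
Unset Printing Implicit Defensive.

(** A multiplier on post-action histories may react to the action just taken.  So
    in [inf_lambda sup_a] the first-period multipliers can be chosen separately
    for each first action, and the infimum moves inside the maximum over the
    finite action set without any minimax theorem; moving past multipliers into
    the weights [gamma] turns the rest of the Lagrangian into that of the
    continuation problem, which is the functional equation.  Truncating [lambda]
    at a late horizon changes the Lagrangian little, uniformly in the plan, so the
    dual value is an infimum over finite-horizon multipliers, and induction on the
    horizon puts every solution of the functional equation in [N] below it.

    For lotteries, integrating the Lagrangian gives weak duality.  Conversely, a
    finite-dimensional minimax argument yields, for finitely many constraints at a
    time, an average of admissible plans that satisfies them and reaches the dual
    value up to a small error.  The limit of these averages along an ultrafilter is
    a finitely additive expectation; on clopen sets of plans it is countably
    additive by compactness, hence extends to a Borel probability, which is an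
    optimal lottery. *)

(** * Real series and finite sums *)

Section RealSeries.
Variable R : realType.
Implicit Types (u v : nat -> R).

Lemma cvg_upper (T : Type) (F : set_system T) {FF : ProperFilter F} (f : T -> R) l c :
  f @ F --> l -> (forall x, f x <= c) -> l <= c.
Proof.
move=> fl fc; rewrite -(cvg_lim (@Rhausdorff R) fl).
by apply: limr_le; [exact: cvgP fl|exact: nearW].
Qed.

Lemma cvg_lower (T : Type) (F : set_system T) {FF : ProperFilter F} (f : T -> R) l c :
  f @ F --> l -> (forall x, c <= f x) -> c <= l.
Proof.
move=> fl fc; rewrite -(cvg_lim (@Rhausdorff R) fl).
by apply: limr_ge; [exact: cvgP fl|exact: nearW].
Qed.

Lemma cvg_sumr (T J : Type) (F : set_system T) {FF : Filter F} (r : seq J)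
    (f : J -> T -> R) (l : J -> R) : (forall j, f j @ F --> l j) ->
  (fun x => \sum_(j <- r) f j x) @ F --> \sum_(j <- r) l j.
Proof.
move=> fl; elim: r => [|j r IH].
  rewrite big_nil; under eq_fun do rewrite big_nil.
  exact: cvg_cst.
rewrite big_cons; under eq_fun do rewrite big_cons.
exact: cvgD.
Qed.

Lemma series_ordE u : series u = (fun n => \sum_(k < n) u k).
Proof. by apply/funext => n; rewrite /series /= big_mkord. Qed.

Lemma cvg_rser u : cvgn (fun n => \sum_(k < n) u k) ->
  (fun n => \sum_(k < n) u k) @ \oo --> rser u.
Proof. by []. Qed.

(** The tail estimate holds for finite blocks by induction on their length and survives the limit.
    Its right-hand side involves [v] only, which later gives truncation errors uniform in the
    plan. *)
Lemma rser_dominated u v : (forall k, `|u k| <= v k) ->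
  cvgn (fun n => \sum_(k < n) v k) ->
  cvgn (fun n => \sum_(k < n) u k) /\
  forall n, `|rser u - \sum_(k < n) u k| <= rser v - \sum_(k < n) v k.
Proof.
move=> uv cv.
have v0 k : 0 <= v k by apply: le_trans (uv k).
have cu : cvgn (fun n => \sum_(k < n) u k).
  rewrite -series_ordE; apply: normed_cvg.
  by apply: (@series_le_cvg _ _ v) => //=; rewrite series_ordE.
split=> // n.
have incr m : `|\sum_(k < m + n) u k - \sum_(k < n) u k| <=
    \sum_(k < m + n) v k - \sum_(k < n) v k.
  elim: m => [|m IH]; first by rewrite add0n !subrr normr0.
  rewrite addSn !big_ord_recr /= addrAC.
  rewrite [X in _ <= X]addrAC.
  by apply: le_trans (ler_normD _ _) _; rewrite lerD.
have vlim m : \sum_(k < m) v k <= rser v.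
  apply: (nondecreasing_cvgn_le _ cv).
  by apply/nondecreasing_seqP => k; rewrite big_ord_recr /= lerDl.
have bnd m : `|\sum_(k < m + n) u k - \sum_(k < n) u k| <= rser v - \sum_(k < n) v k.
  by apply: le_trans (incr m) _; rewrite lerB.
have cu' : (fun m => \sum_(k < m + n) u k) @ \oo --> rser u.
  by rewrite (@cvg_shiftn _ _ (fun m => \sum_(k < m) u k)).
rewrite ler_norml lerBrDr lerBlDr; apply/andP; split.
  apply: (cvg_lower cu') => m; rewrite -lerBrDr.
  by have := bnd m; rewrite ler_norml => /andP[].
apply: (cvg_upper cu') => m; rewrite -lerBlDr.
by have := bnd m; rewrite ler_norml => /andP[].
Qed.

Lemma rser_geometric u (b C : R) : 0 < b < 1 -> (forall k, `|u k| <= C * b ^+ k) ->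
  cvgn (fun n => \sum_(k < n) u k) /\
  forall n, `|rser u - \sum_(k < n) u k| <= C / (1 - b) * b ^+ n.
Proof.
move=> /andP[b0 b1] ub.
have nb : `|b| < 1 by rewrite gtr0_norm.
have cg := @cvg_geometric_series R C b nb.
have cv : cvgn (fun n => \sum_(k < n) (C * b ^+ k)).
  by have /cvgP := cg; rewrite series_ordE.
have [cu tl] := rser_dominated ub cv.
split=> // n; apply: le_trans (tl n) _.
have -> : rser (fun k => C * b ^+ k) = C / (1 - b).
  apply: (cvg_unique (@Rhausdorff R)) (cvg_rser cv) _.
  by rewrite -(series_ordE (fun k => C * b ^+ k)).
have := @geometric_seriesE R C b; rewrite lt_eqF// => /(_ isT).
move=> /(congr1 (fun f => f n)) /=; rewrite series_ordE /= => ->.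
rewrite -subr_ge0 (_ : _ - _ = 0)//; field.
by rewrite subr_eq0 gt_eqF.
Qed.

(* [k + 2 <= 2 (3/2)^k] turns the linear growth of the sup norms over the boxes
   [Bk] into a geometric series of ratio 3/4. *)
Lemma half_pow_linear_le (k : nat) : (2 : R) ^- k.+1 * k.+1%:R <= (3 / 4) ^+ k.
Proof.
have bern : k.+2%:R <= 2 * (3 / 2 : R) ^+ k.
  elim: k => [|k IH]; first by rewrite expr0 mulr1.
  have k2 : (2 : R) <= k.+2%:R by rewrite ler_nat.
  by rewrite exprS -(natr1 k.+2); lra.
rewrite mulrC ler_pdivrMr ?exprn_gt0//.
apply: (@le_trans _ _ k.+2%:R); first by rewrite ler_nat.
apply: le_trans bern _; rewrite exprS mulrCA -exprMn (_ : 3 / 4 * 2 = 3 / 2)//.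
by field.
Qed.

Lemma partial_geometric_le (c q : R) n : 0 <= c -> 0 < q < 1 ->
  \sum_(k < n) c * q ^+ k <= c / (1 - q).
Proof.
move=> c0 /andP[q0 q1]; have := @geometric_le_lim R n c q c0 q0.
by rewrite gtr0_norm// => /(_ q1); rewrite series_ordE.
Qed.

Lemma nneseries_le_geometric (u : nat -> \bar R) (c q : R) : 0 <= c -> 0 < q < 1 ->
  (forall k, 0 <= u k)%E -> (forall k, u k <= (c * q ^+ k)%:E)%E ->
  (\sum_(k <oo) u k <= (c / (1 - q))%:E)%E.
Proof.
move=> c0 hq u0 uc; apply: lime_le; first by apply: is_cvg_nneseries.
apply: nearW => n; rewrite big_mkord.
apply: (@le_trans _ _ (\sum_(k < n) (c * q ^+ k)%:E)%E); first exact: lee_sum.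
by rewrite sumEFin lee_fin partial_geometric_le.
Qed.

(** Since [pickle] is injective, the sum over [T] is a subsum of a geometric series with total
    [c]. *)
Lemma esum_pickle_le (T : countType) (c : R) : 0 <= c ->
  (\esum_(x in [set: T]) ((2 : R) ^- (pickle x).+1 * c)%:E <= c%:E)%E.
Proof.
move=> c0; have e0 n : (0 <= ((2 : R) ^- n.+1 * c)%:E)%E.
  by rewrite lee_fin mulr_ge0// invr_ge0 exprn_ge0.
have inj : set_inj [set: T] (@pickle T) by move=> x y _ _; exact: (pcan_inj pickleK).
rewrite -(esum_image setT (@pickle T) (fun n => ((2 : R) ^- n.+1 * c)%:E) inj).
rewrite (@le_trans _ _ (\sum_(n <oo) ((2 : R) ^- n.+1 * c)%:E)%E)//.
  rewrite nneseries_esumT// esum_mkcond; apply: le_esum => n _.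
  by case: ifP.
have := @nneseries_le_geometric (fun n => ((2 : R) ^- n.+1 * c)%:E) (c / 2) (1 / 2).
rewrite (_ : c / 2 / (1 - 1 / 2) = c); last by field.
apply; [by rewrite divr_ge0|lra|by []|move=> n].
by rewrite lee_fin exprS invfM mul1r exprVn le_eqVlt; apply/orP; left; apply/eqP; ring.
Qed.

Lemma cvg_series_finite (u : nat -> R) T : (forall t, (T <= t)%N -> u t = 0) ->
  cvgn (fun n => \sum_(t < n) u t).
Proof.
move=> u0; apply/cvg_ex; exists (\sum_(t < T) u t); apply: cvg_near_cst.
exists T => // n /= Tn; rewrite -(subnKC Tn) big_split_ord /=.
by rewrite [X in _ + X]big1 ?addr0// => k _; rewrite u0// leq_addr.
Qed.

End RealSeries.

Lemma big_tuple0 (R : nmodType) (T : finType) (F : seq T -> R) :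
  \sum_(w : 0.-tuple T) F w = F [::].
Proof.
rewrite (bigD1 [tuple]) //= big1 ?addr0// => w.
by rewrite (tuple0 w) => /eqP.
Qed.

Lemma big_tupleS (R : nmodType) (T : finType) n (F : seq T -> R) :
  \sum_(w : n.+1.-tuple T) F w = \sum_(x : T) \sum_(w : n.-tuple T) F (x :: w).
Proof.
rewrite pair_big /= (reindex (fun p : T * n.-tuple T => [tuple of p.1 :: p.2]))//=.
exists (fun w : n.+1.-tuple T => (thead w, [tuple of behead w])) => [[x w] _|w _] /=.
  by congr pair; apply/val_inj.
by rewrite -tuple_eta.
Qed.

Lemma ler_sum_inj (R : numDomainType) (T T' : finType) (f : T -> T') (F : T' -> R) :
  injective f -> (forall y, 0 <= F y) -> \sum_x F (f x) <= \sum_y F y.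
Proof.
move=> finj F0; rewrite [leRHS](bigID (mem (f @: finset.setTfor T)))/=.
rewrite big_imset /=; last by move=> x y _ _; exact: finj.
rewrite [X in _ <= X + _](eq_bigl xpredT); last by move=> x; rewrite finset.in_setT.
by rewrite lerDl sumr_ge0.
Qed.

(** Finitely many strict inequalities share a margin. Applied to the finite action set, this
    replaces attainment of a maximum in the contradiction arguments below. *)
Lemma finite_gap (R : realFieldType) (T : finType) (P : T -> Prop) (v : T -> R) (u : R) :
  (forall b, P b -> v b < u) -> exists2 e, 0 < e & forall b, P b -> v b <= u - e.
Proof.
(* The default 1 keeps the minimum positive when no index satisfies [P]. *)
move=> vu; pose e b := if asbool (P b) then u - v b else 1.
exists (\big[Num.min/1]_b e b) => [|b Pb].
  apply: lt_bigmin => // b _; rewrite /e; case: asboolP => // Pb.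
  by rewrite subr_gt0 vu.
rewrite lerBrDr -lerBrDl; apply: le_trans (bigmin_le _ b _) _.
by rewrite /e; case: asboolP.
Qed.

(** * Finitely additive expectations *)

Lemma ultra_map (T T' : Type) (f : T -> T') (F : set_system T) :
  UltraFilter F -> UltraFilter (f @ F).
Proof.
move=> UF; split=> [|G GG sG]; first exact: fmap_proper_filter.
rewrite predeqE => A; split=> [GA|]; last exact: sG.
have [//|FnA] := in_ultra_setVsetC (f @^-1` A) UF.
have /sG GnA : (f @ F) (~` A) by [].
by have /filter_ex[? []] : G (A `&` ~` A) by exact: filterI.
Qed.

(** Otherwise the ultrafilter contains the complement of each of the finitely many fibres, hence
    their empty intersection. *)
Lemma ultra_finite (T : Type) (J : finType) (f : T -> J) (F : set_system T) :
  UltraFilter F -> exists j, F [set x | f x = j].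
Proof.
move=> UF; apply: contrapT => H.
have nF j : F (~` [set x | f x = j]).
  by have [h|//] := in_ultra_setVsetC [set x | f x = j] UF; case: H; exists j.
have : F [set x | forall j, f x <> j] by apply: filter_forall => j; exact: nF.
by move=> /filter_ex[x /(_ (f x))].
Qed.

Section Means.
Variables (R : realType) (T : Type).
Implicit Types (f g : T -> R) (m : (T -> R) -> R) (P : T -> Prop).

Definition bounded f := exists B : R, forall a, `|f a| <= B.

Lemma bounded_lin (u v : R) f g : bounded f -> bounded g ->
  bounded (fun a => u * f a + v * g a).
Proof.
move=> [B hB] [C hC]; exists (`|u| * B + `|v| * C) => a.
by apply: le_trans (ler_normD _ _) _; rewrite !normrM lerD// ler_wpM2l.
Qed.

Lemma bounded_cst (c : R) : bounded (fun=> c).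
Proof. by exists `|c|. Qed.

(* A finitely additive expectation carried by [P]. *)
Record mean P m : Prop := Mean {
  mean_lin : forall u v f g, bounded f -> bounded g ->
    m (fun a => u * f a + v * g a) = u * m f + v * m g;
  mean_le : forall f g, bounded f -> bounded g ->
    (forall a, P a -> f a <= g a) -> m f <= m g;
  mean_cst : forall c, m (fun=> c) = c }.

Lemma mean_dirac P a : P a -> mean P (fun f => f a).
Proof. by move=> Pa; split=> // f g _ _; exact. Qed.

Lemma mean_mix P m m' (t : R) : 0 <= t <= 1 -> mean P m -> mean P m' ->
  mean P (fun f => (1 - t) * m f + t * m' f).
Proof.
move=> /andP[t0 t1] mm mm'; split=> [u v f g bf bg|f g bf bg fg|c].
- by rewrite !(mean_lin mm, mean_lin mm')//; ring.
- by apply: lerD; apply: ler_wpM2l; rewrite ?subr_ge0//;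
    [exact: (mean_le mm)|exact: (mean_le mm')].
- by rewrite !(mean_cst mm, mean_cst mm'); ring.
Qed.

Lemma norm_mean_le P m f (B : R) : mean P m -> (forall a, `|f a| <= B) -> `|m f| <= B.
Proof.
move=> mm fB; have bf : bounded f by exists B.
have fB' a : - B <= f a /\ f a <= B by have := fB a; rewrite ler_norml => /andP.
rewrite ler_norml -{1}(mean_cst mm (- B)) -{2}(mean_cst mm B); apply/andP; split.
  by apply: (mean_le mm) => [||a _]; [exact: bounded_cst|by []|exact: (fB' a).1].
by apply: (mean_le mm) => [||a _]; [by []|exact: bounded_cst|exact: (fB' a).2].
Qed.

Lemma mean_dist P m f g (e : R) : mean P m -> bounded f -> bounded g ->
  (forall a, `|f a - g a| <= e) -> `|m f - m g| <= e.
Proof.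
move=> mm bf bg h.
have -> : m f - m g = m (fun a => 1 * f a + (-1) * g a).
  by rewrite (mean_lin mm)// mul1r mulN1r.
by apply: (norm_mean_le mm) => a; rewrite mul1r mulN1r.
Qed.

Lemma mean_sum P m (J : finType) (f : J -> T -> R) : mean P m -> (forall j, bounded (f j)) ->
  m (fun a => \sum_j f j a) = \sum_j m (f j).
Proof.
move=> mm bf; have h r : bounded (fun a => \sum_(j <- r) f j a) /\
    m (fun a => \sum_(j <- r) f j a) = \sum_(j <- r) m (f j).
  elim: r => [|j r [br IH]].
    rewrite big_nil; under eq_fun do rewrite big_nil.
    by split; [exact: bounded_cst|exact: mean_cst mm 0].
  have e : (fun a => \sum_(i <- j :: r) f i a) =
      fun a => 1 * f j a + 1 * \sum_(i <- r) f i a.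
    by apply/funext => a; rewrite big_cons !mul1r.
  rewrite e big_cons; split; first exact: bounded_lin.
  by rewrite (mean_lin mm)// !mul1r IH.
exact: (h _).2.
Qed.

(* Minimax: otherwise the mean minimising the squared distance [dist] to the
   nonnegative orthant could be improved by mixing in a Dirac mass that is
   nonnegative in the direction of the defects. *)
Lemma mean_nonneg P (J : finType) (c : J -> T -> R) (e : R) :
  (forall j, bounded (c j)) ->
  (forall y : J -> R, (forall j, 0 <= y j) ->
    exists2 a, P a & 0 <= \sum_j y j * c j a) ->
  0 < e -> exists2 m, mean P m & forall j, - e <= m (c j).
Proof.
move=> /boolp.choice[B hB] hy e0.
pose defect m j := Num.max 0 (- m (c j)).
pose dist m := \sum_j defect m j ^+ 2.
pose K := \sum_j (2 * B j) ^+ 2.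
have K0 : 0 <= K by apply: sumr_ge0 => j _; exact: sqr_ge0.
have y0 m j : 0 <= defect m j by rewrite /defect le_max lexx.
(* Mixing in weight [t] of a Dirac mass gains [2 * t * dist m] to first order and costs at most
   [t ^+ 2 * K] to second order. *)
have step m (t : R) : mean P m -> 0 <= t <= 1 -> exists2 m', mean P m' &
    dist m' <= (1 - 2 * t) * dist m + t ^+ 2 * K.
  move=> mm t01; have [a Pa ha] := hy _ (y0 m).
  exists (fun f => (1 - t) * m f + t * f a).
    exact: (mean_mix t01 mm (mean_dirac Pa)).
  apply: (@le_trans _ _ (\sum_j (defect m j ^+ 2 -
    2 * t * (defect m j * c j a + defect m j ^+ 2) + t ^+ 2 * (2 * B j) ^+ 2))).
    apply: ler_sum => j _; pose w := c j a - m (c j).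
    apply: (@le_trans _ _ ((defect m j - t * w) ^+ 2)).
      rewrite {1}/defect (_ : (1 - t) * m (c j) + t * c j a = m (c j) + t * w); last first.
        by rewrite /w; ring.
      have h : - (m (c j) + t * w) <= defect m j - t * w.
        by rewrite opprD lerD2r /defect le_max lexx orbT.
      case: (lerP 0 (- (m (c j) + t * w))) => [h0|_]; last by rewrite expr0n sqr_ge0.
      by rewrite ler_sqr ?nnegrE// (le_trans h0).
    (* Complementarity: a defect is either zero or equal to [- m (c j)], so the cross term becomes
       the square of the defect. *)
    have yz : defect m j * - m (c j) = defect m j ^+ 2.
      rewrite /defect; case: (lerP 0 (- m (c j))) => _; first by rewrite expr2.
      by rewrite mul0r expr0n.
    have -> : (defect m j - t * w) ^+ 2 = defect m j ^+ 2 -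
        2 * t * (defect m j * c j a + defect m j * - m (c j)) + t ^+ 2 * w ^+ 2.
      by rewrite /w; ring.
    rewrite yz lerD2l ler_wpM2l ?sqr_ge0// -real_normK ?num_real//.
    rewrite ler_sqr ?nnegrE ?normr_ge0//.
      rewrite mulr_natl mulr2n; apply: le_trans (ler_normB _ _) _; rewrite lerD//.
      exact: norm_mean_le mm (hB j).
    by rewrite mulr_ge0// (le_trans (normr_ge0 _) (hB j a)).
  rewrite big_split sumrB /= -!mulr_sumr big_split /= -/(dist m) -/K lerD2r.
  have t0 : 0 <= t by case/andP: t01.
  have : 0 <= t * \sum_j defect m j * c j a by rewrite mulr_ge0.
  by lra.
pose V := [set dist m | m in mean P].
have V0 : has_inf V.
  split; last by exists 0 => _ [m _ <-]; apply: sumr_ge0 => j _; exact: sqr_ge0.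
  have [a Pa _] := hy (fun=> 0) (fun=> lexx 0).
  by exists (dist (fun f => f a)), (fun f => f a) => //; exact: mean_dirac.
(* If the infimum is zero, some mean has squared distance below [e ^+ 2], so each single defect is
   at most [e]. *)
have [d0|d0] := leP (inf V) 0.
  have e2 : 0 < e ^+ 2 by rewrite exprn_gt0.
  have [_ [m mm <-] hm] := inf_adherent e2 V0.
  exists m => // j; rewrite lerNl; apply: (@le_trans _ _ (defect m j)).
    by rewrite /defect le_max lexx orbT.
  rewrite -ler_sqr ?nnegrE ?(ltW e0)//; apply: le_trans (le_trans (ltW hm) _).
    by rewrite /dist (bigD1 j)//= lerDl sumr_ge0// => i _; exact: sqr_ge0.
  by rewrite gerDr.
exfalso; set d := inf V in d0.
(* The bound 1/2 keeps [1 - 2 * t] nonnegative, and [t * (K + 1) <= d] makes the second-order cost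
   at most [t * d - t ^+ 2]. A mean with distance below [d + t * d] is then improved to strictly
   less than the infimum [d]. *)
pose t := Num.min (1 / 2) (d / (K + 1)).
have K1 : 0 < K + 1 by rewrite ltr_wpDl.
have t0 : 0 < t by rewrite lt_min divr_gt0 ?divr_gt0.
have th : t <= 1 / 2 by rewrite ge_min lexx.
have td : t * (K + 1) <= d by rewrite -ler_pdivlMr// ge_min lexx orbT.
have [_ [m mm <-] hm] := inf_adherent (mulr_gt0 t0 d0) V0.
have t01 : 0 <= t <= 1 by apply/andP; split; lra.
have [m' mm' hm'] := step m t mm t01.
have : d <= dist m' by apply: ge_inf; [exact: V0.2|exists m'].
rewrite -/d in hm; move=> h.
have h1 : (1 - 2 * t) * dist m <= (1 - 2 * t) * (d + t * d).
  by rewrite ler_wpM2l ?(ltW hm)// subr_ge0; lra.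
have h2 : t ^+ 2 * K <= t * d - t ^+ 2.
  by rewrite -subr_ge0 (_ : _ - _ = t * (d - t * (K + 1))) ?mulr_ge0 ?subr_ge0 ?(ltW t0)//; ring.
have h3 : 0 < t ^+ 2 by rewrite exprn_gt0.
have h4 : 0 <= t ^+ 2 * d by rewrite mulr_ge0 ?(ltW h3)// ltW.
have h5 : (1 - 2 * t) * (d + t * d) = d - t * d - 2 * (t ^+ 2 * d) by ring.
by lra.
Qed.

(** One ultrafilter refining [\oo] makes [m n f] converge for all bounded [f] at once, by
    compactness of the segment containing these values. Linearity, monotonicity and eventual lower
    bounds pass to the limit. *)
Lemma mean_ultralimit P (m : nat -> (T -> R) -> R) : (forall n, mean P (m n)) ->
  exists2 E, mean P E & forall f l, bounded f ->
    (forall e, 0 < e -> \forall n \near \oo, l - e <= m n f) -> l <= E f.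
Proof.
move=> mm; have [U [UU sU]] := @ultraFilterLemma nat \oo _.
have cvgU f : bounded f -> cvg (m n f @[n --> U]).
  move=> [B hB]; have UV : UltraFilter (m n f @[n --> U]) by apply: ultra_map.
  have mB : (m n f @[n --> U]) `[- B, B]%classic.
    rewrite /fmap /=; apply: (@nearW _ U) => n /=.
    by rewrite in_itv /= -ler_norml (norm_mean_le (mm n)).
  have := @segment_compact R (- B) B.
  by rewrite compact_ultra => /(_ _ UV mB) [l [_ ml]]; apply/cvg_ex; exists l.
exists (fun f => lim (m n f @[n --> U])); last first.
  move=> f l bf h; apply/ler_addgt0Pr => e e0; rewrite -lerBlDr.
  by apply: limr_ge; [exact: cvgU|exact/sU/h].
split=> [u v f g bf bg|f g bf bg fg|c].
- apply: cvg_lim => //.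
  have -> : (fun n => m n (fun a => u * f a + v * g a)) = fun n => u * m n f + v * m n g.
    by apply/funext => n; rewrite (mean_lin (mm n)).
  by apply: cvgD; apply: cvgM; [exact: cvg_cst|exact: cvgU|exact: cvg_cst|exact: cvgU].
- apply: ler_lim; [exact: cvgU|exact: cvgU|].
  by apply: nearW => n; exact: (mean_le (mm n)).
- apply: cvg_lim => //; rewrite (_ : (fun n => _) = fun=> c); first exact: cvg_cst.
  by apply/funext => n; rewrite (mean_cst (mm n)).
Qed.

End Means.

(** * Probability measures on plans *)

Section Clopen.
Variables (R : realType) (M : model R).
Local Notation S := (St M).
Local Notation A := (Ac M).
Implicit Types (a b : plan M) (C : set (plan M)).

(** Membership is decided by finitely many coordinates; as the action set is finite, these are the
    clopen sets of the product topology. *)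
Definition clopen : set (set (plan M)) := [set C | exists hs : seq (S * seq S),
  forall a b, (forall h, h \in hs -> a h = b h) -> C a -> C b].

Lemma clopen0 : clopen set0.
Proof. by exists [::]. Qed.

Lemma clopenU : setU_closed clopen.
Proof.
move=> C D [hs hC] [hs' hD]; exists (hs ++ hs') => a b ab [Ca|Da].
  by left; apply: hC Ca => h hh; rewrite ab// mem_cat hh.
by right; apply: hD Da => h hh; rewrite ab// mem_cat hh orbT.
Qed.

Lemma clopenC : setC_closed clopen.
Proof.
move=> C [hs hC]; exists hs => a b ab nCa Cb; apply: nCa.
by apply: hC Cb => h hh; rewrite ab.
Qed.

(* A sequence of plans has a limit along an ultrafilter, coordinate by
   coordinate, because there are finitely many actions. *)
Lemma clopen_compact C (F : nat -> set (plan M)) : clopen C ->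
  (forall n, clopen (F n)) -> C `<=` \bigcup_n F n ->
  exists N, forall a, C a -> exists2 k, (k < N)%N & F k a.
Proof.
move=> cC cF CF; apply: contrapT => H.
have /boolp.choice[u hu] : forall N, exists a, C a /\ forall k, (k < N)%N -> ~ F k a.
  move=> N; apply: contrapT => Hn; apply: H; exists N => a Ca; apply: contrapT => Ha.
  by apply: Hn; exists a; split=> // k kN Fka; apply: Ha; exists k.
have [U [UU sU]] := @ultraFilterLemma nat \oo _.
have /boolp.choice[v hv] : forall h, exists y, U [set n | u n h = y].
  by move=> h; exact: ultra_finite.
have nearv (hs : seq (S * seq S)) : U [set n | forall h, h \in hs -> u n h = v h].
  elim: hs => [|h hs IH]; first exact: filterS (filterT : U setT).
  apply: filterS (filterI (hv h) IH) => n [e ehs] h'.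
  by rewrite inE => /orP[/eqP ->|/ehs].
have [hs hC] := cC; have [n hn] := filter_ex (nearv hs).
have [k _ Fkv] := CF v (hC _ _ hn (hu n).1).
have [hs' hF] := cF k.
(* The ultrafilter refines [\oo], so some index beyond [k] agrees with [v] on the coordinates that
   decide [F k]; but [u] at that index avoids [F k]. *)
have kU : U [set n | (k < n)%N] by apply: sU; exists k.+1.
have [n' [hn' kn']] := filter_ex (filterI (nearv hs') kU).
apply: ((hu n').2 _ kn'); apply: hF Fkv => h hh.
by rewrite hn'.
Qed.

End Clopen.

(* The plans, with the algebra of clopen sets instead of the sigma-algebra
   generated by the cylinders. *)
Definition clopen_plan (R : realType) (M : model R) := plan M.
HB.instance Definition _ R M := Choice.on (@clopen_plan R M).
HB.instance Definition _ R M := Pointed.on (@clopen_plan R M).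
HB.instance Definition _ (R : realType) (M : model R) :=
  @isAlgebraOfSets.Build default_measure_display (@clopen_plan R M)
    (@clopen R M) (@clopen0 R M) (@clopenU R M) (@clopenC R M).

Lemma bounded_indic (R : realType) (T : Type) (C : set T) : bounded (\1_C : T -> R).
Proof. by exists 1 => a; rewrite indicE; case: (_ \in _); rewrite ?normr0 ?normr1. Qed.

Section MeanMeasure.
Variables (R : realType) (M : model R) (P : plan M -> Prop) (E : (plan M -> R) -> R).
Hypothesis mE : mean P E.
Implicit Types (a b : plan M) (C : set (plan M)).

Definition premeasure_of_mean (_ : mean P E) (C : set (clopen_plan M)) : \bar R :=
  (E (\1_C))%:E.
Local Notation mu := (premeasure_of_mean mE).

Let mu0 : mu set0 = 0%E.
Proof. by rewrite /premeasure_of_mean indic0 (mean_cst mE). Qed.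

Let mu_ge0 C : (0 <= mu C)%E.
Proof.
rewrite lee_fin -(mean_cst mE 0); apply: (mean_le mE) => [||a _].
- exact: bounded_cst.
- exact: bounded_indic.
by rewrite indicE ler0n.
Qed.

(** By compactness, finitely many of the disjoint sets already cover their clopen union, so the
    partial sums are eventually constant and finite additivity of [E] suffices. *)
Let mu_sigma_additive : semi_sigma_additive mu.
Proof.
move=> F cF tF cUF.
have [N hN] := @clopen_compact R M (\bigcup_n F n) F cUF cF (@subset_refl _ _).
apply: cvg_near_cst; exists N => // n /= Nn.
rewrite big_mkord /premeasure_of_mean sumEFin; congr (_%:E).
rewrite -(mean_sum (f := fun (i : 'I_n) => \1_(F i)) mE); last by move=> i; exact: bounded_indic.
congr E; apply/funext => a; rewrite indicE.
have [aU|aU] := boolP (a \in \bigcup_n F n); last first.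
  apply: big1 => i _; rewrite indicE; case: (boolP (a \in F i)) => // aF.
  by case/negP: aU; rewrite inE; exists i => //; rewrite -in_setE.
have [k kN Fka] := hN a (set_mem aU).
rewrite (bigD1 (Ordinal (leq_trans kN Nn)))//= indicE mem_set// big1 ?addr0// => i ik.
rewrite indicE; case: (boolP (a \in F i)) => // /set_mem Fia.
have : i = k :> nat by apply: tF => //; exists a; split.
by move=> e; case/eqP: ik; apply/val_inj.
Qed.

HB.instance Definition _ := isMeasure.Build _ _ _ mu mu0 mu_ge0 mu_sigma_additive.

Local Notation PlanM := (g_sigma_algebraType (@cyl R M)).
Local Notation ClopenM := (g_sigma_algebraType (@measurable _ (clopen_plan M))).

Lemma cyl_clopen C : cyl C -> clopen C.
Proof.
by move=> [h [y ->]]; exists [:: h] => a b ab /= <-; rewrite ab// inE.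
Qed.

Let measurable_clopen (C : set PlanM) :
  measurable C -> measurable (C : set ClopenM).
Proof.
apply: smallest_sub; first exact: smallest_sigma_algebra.
by move=> D cD; apply: sub_gen_smallest; exact: cyl_clopen.
Qed.

(** The Caratheodory extension lives on the sigma-algebra generated by the clopen sets; it restricts
    to plans because cylinders are clopen. *)
Definition law_of_mean (C : set PlanM) : \bar R :=
  measure_extension mu (C : set ClopenM).
Local Notation law := law_of_mean.

Let law0 : law set0 = 0%E.
Proof. exact: (@measure0 _ _ _ (measure_extension mu)). Qed.

Let law_ge0 C : (0 <= law C)%E.
Proof. exact: (@measure_ge0 _ _ _ (measure_extension mu)). Qed.

Let law_sigma_additive : semi_sigma_additive law.
Proof.
move=> F mF tF mUF; apply: (@measure_semi_sigma_additive _ _ _ (measure_extension mu)) => //.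
  by move=> i; exact: measurable_clopen.
exact: measurable_clopen.
Qed.

HB.instance Definition _ := isMeasure.Build _ _ _ law law0 law_ge0 law_sigma_additive.

Lemma law_clopen C : clopen C -> law C = (E (\1_C))%:E.
Proof. by move=> cC; rewrite /law_of_mean /measure_extension measurable_mu_extE. Qed.

Let lawT : law setT = 1%E.
Proof.
rewrite law_clopen ?indicT ?(mean_cst mE)//.
by rewrite -setC0; apply: clopenC; exact: clopen0.
Qed.

HB.instance Definition _ := Measure_isProbability.Build _ _ _ law lawT.

End MeanMeasure.

(** * Measurable functions of plans and their expectations *)

Section PlanFunctions.
Variables (R : realType) (M : model R).
Local Notation S := (St M).
Local Notation A := (Ac M).
Local Notation X := (Xs M).
Local Notation PlanM := (g_sigma_algebraType (@cyl R M)).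
Implicit Types (a b : plan M) (phi psi : plan M -> R) (x : X) (s : S) (w : seq S).

Definition fin_det phi := exists hs : seq (S * seq S),
  forall a b, (forall h, h \in hs -> a h = b h) -> phi a = phi b.

Lemma fin_det_map phi hs : (forall a b, map a hs = map b hs -> phi a = phi b) -> fin_det phi.
Proof.
by move=> h; exists hs => a b ab; apply: h; apply/eq_in_map => k kh; exact: ab.
Qed.

Lemma fin_det2 (F : R -> R -> R) phi psi : fin_det phi -> fin_det psi ->
  fin_det (fun a => F (phi a) (psi a)).
Proof.
move=> [hs hp] [hs' hp']; exists (hs ++ hs') => a b ab.
by congr F; [apply: hp|apply: hp'] => h hh; rewrite ab// mem_cat hh ?orbT.
Qed.

Lemma fin_det_cst (c : R) : fin_det (fun=> c).
Proof. by exists [::]. Qed.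

Lemma fin_det_sum (J : finType) (F : J -> plan M -> R) : (forall j, fin_det (F j)) ->
  fin_det (fun a => \sum_j F j a).
Proof.
move=> h; suff : forall r, fin_det (fun a => \sum_(j <- r) F j a) by apply.
elim=> [|j r IH].
  by under eq_fun do rewrite big_nil; exact: fin_det_cst.
by under eq_fun do rewrite big_cons; exact: fin_det2.
Qed.

Definition pattern (hs : seq (S * seq S)) (ys : seq A) : set (plan M) :=
  [set a : plan M | map a hs = ys].

Lemma pattern_clopen hs ys : clopen (pattern hs ys).
Proof.
exists hs => a b ab <-; apply/eq_in_map => h hh.
by rewrite ab.
Qed.

Lemma measurable_pattern hs ys : measurable (pattern hs ys : set PlanM).
Proof.
elim: hs ys => [|h hs IH] [|y ys].
- by rewrite (_ : pattern _ _ = setT)//; apply/seteqP; split.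
- by rewrite (_ : pattern _ _ = set0)//; apply/seteqP; split.
- by rewrite (_ : pattern _ _ = set0)//; apply/seteqP; split.
rewrite (_ : pattern _ _ = [set a | a h = y] `&` pattern hs ys).
  by apply: measurableI => //; apply: sub_gen_smallest; exists h, y.
by apply/seteqP; split => a /=; rewrite /pattern /= => -[-> ->].
Qed.

(** Finitely many coordinates with values in a finite set give finitely many patterns, on each of
    which [phi] is constant. Such functions are thus simple functions over clopen sets. *)
Lemma fin_det_expand phi : fin_det phi -> exists hs (c : (size hs).-tuple A -> R),
  phi = fun a => \sum_(ys : (size hs).-tuple A) c ys * \1_(pattern hs ys) a.
Proof.
move=> [hs hphi]; exists hs.
have /boolp.choice[c hc] : forall ys : (size hs).-tuple A, exists v, forall a,
    pattern hs ys a -> phi a = v.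
  move=> ys; have [[a pa]|np] := pselect (exists a, pattern hs ys a); last first.
    by exists 0 => a pa; case: np; exists a.
  exists (phi a) => b pb; apply: hphi => h hh.
  by apply/eq_in_map : h hh; rewrite pa pb.
exists c; apply/funext => a.
have sz : size (map a hs) == size hs by rewrite size_map.
rewrite (bigD1 (Tuple sz))//= indicE mem_set// mulr1 big1 ?addr0; first exact: hc.
move=> ys nys; rewrite indicE; case: (boolP (a \in _)); last by rewrite mulr0.
by rewrite inE => e; case/eqP: nys; apply/val_inj; rewrite /= -e.
Qed.

Definition bmeas (phi : PlanM -> R) := measurable_fun setT phi /\ bounded phi.

Lemma bmeas_cst (c : R) : bmeas (fun=> c).
Proof. by split; [exact: measurable_cst|exact: bounded_cst]. Qed.

Lemma bmeas_lin (u v : R) phi psi : bmeas phi -> bmeas psi ->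
  bmeas (fun a => u * phi a + v * psi a).
Proof.
move=> [m1 b1] [m2 b2]; split; last exact: bounded_lin.
apply: measurable_funD; apply: measurable_funM.
- exact: measurable_cst.
- exact: m1.
- exact: measurable_cst.
- exact: m2.
Qed.

Lemma bmeasZ (u : R) phi : bmeas phi -> bmeas (fun a => u * phi a).
Proof.
move=> b1; have := bmeas_lin u 0 b1 (bmeas_cst 0).
by under eq_fun do rewrite mulr0 addr0.
Qed.

Lemma bmeasD phi psi : bmeas phi -> bmeas psi -> bmeas (fun a => phi a + psi a).
Proof.
move=> b1 b2; have := bmeas_lin 1 1 b1 b2.
by under eq_fun do rewrite !mul1r.
Qed.

Lemma bmeas_sum (J : finType) (F : J -> plan M -> R) : (forall j, bmeas (F j)) ->
  bmeas (fun a => \sum_j F j a).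
Proof.
move=> h; suff : forall r, bmeas (fun a => \sum_(j <- r) F j a) by apply.
elim=> [|j r IH].
  by under eq_fun do rewrite big_nil; exact: bmeas_cst.
by under eq_fun do rewrite big_cons; exact: bmeasD.
Qed.

Lemma bmeas_indic (C : set PlanM) : measurable C -> bmeas (\1_C).
Proof. by move=> mC; split; [exact: measurable_indic|exact: bounded_indic]. Qed.

Lemma bmeas_fin_det phi : fin_det phi -> bmeas phi.
Proof.
move=> /fin_det_expand[hs [c ->]]; apply: bmeas_sum => ys.
by apply: bmeasZ; apply: bmeas_indic; exact: measurable_pattern.
Qed.

Lemma bmeas_lim (F : nat -> plan M -> R) phi : (forall n, bmeas (F n)) -> bounded phi ->
  (forall a, F n a @[n --> \oo] --> phi a) -> bmeas phi.
Proof.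
move=> bF bphi Fphi; split=> //.
apply: (@measurable_fun_cvg _ PlanM R setT F) => [n|a _]; first exact: (bF n).1.
exact: Fphi.
Qed.

Lemma clopen_indic (C : set (plan M)) : clopen C -> fin_det (\1_C).
Proof.
move=> [hs hC]; exists hs => a b ab; rewrite !indicE; congr ((_ : bool)%:R).
apply/idP/idP; rewrite !inE; first exact: hC.
by apply: hC => h hh; rewrite ab.
Qed.

Lemma measurable_clopen_set (C : set PlanM) : clopen C -> measurable C.
Proof.
move=> cC; have [mC _] := bmeas_fin_det (clopen_indic cC).
rewrite (_ : C = setT `&` \1_C @^-1` [set (1 : R)]).
  by apply: mC => //; exact: measurable_set1.
rewrite setTI; apply/seteqP; split=> a /=; rewrite indicE.
  by move=> Ca; rewrite mem_set.
by case: (boolP (a \in C)) => [/set_mem//|_ /eqP]; rewrite eq_sym oner_eq0.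
Qed.

Section Integral.
Variable Pr : probability PlanM R.

Definition expect phi : R := \int[Pr]_(a in setT) phi a.

Lemma bmeas_integrable phi : bmeas phi -> Pr.-integrable setT (EFin \o phi).
Proof.
move=> [mphi [B hB]]; apply: measurable_bounded_integrable => //.
  exact: (le_lt_trans (probability_le1 Pr measurableT) (ltry 1)).
exists B; split; first exact: num_real.
by move=> y By a _ /=; rewrite (le_trans (hB a))// ltW.
Qed.

Lemma integral_bmeas phi : bmeas phi ->
  (\int[Pr]_(a in setT) (phi a)%:E = (expect phi)%:E)%E.
Proof.
move=> bphi; rewrite /expect /Rintegral fineK//.
by apply: integrable_fin_num => //; exact: bmeas_integrable.
Qed.

Lemma expect_cst (c : R) : expect (fun=> c) = c.
Proof. by rewrite /expect Rintegral_cst//= probability_setT mulr1. Qed.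

Lemma expectZ (u : R) phi : bmeas phi -> expect (fun a => u * phi a) = u * expect phi.
Proof. by move=> b; rewrite /expect RintegralZl//; exact: bmeas_integrable. Qed.

Lemma expectD phi psi : bmeas phi -> bmeas psi ->
  expect (fun a => phi a + psi a) = expect phi + expect psi.
Proof. by move=> b1 b2; rewrite /expect RintegralD//; exact: bmeas_integrable. Qed.

Lemma expect_sum (J : finType) (F : J -> plan M -> R) : (forall j, bmeas (F j)) ->
  expect (fun a => \sum_j F j a) = \sum_j expect (F j).
Proof.
move=> h; suff : forall r, bmeas (fun a => \sum_(j <- r) F j a) /\
    expect (fun a => \sum_(j <- r) F j a) = \sum_(j <- r) expect (F j).
  by move=> /(_ (index_enum J))[].
elim=> [|j r [br IH]].
  rewrite big_nil; under eq_fun do rewrite big_nil.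
  by split; [exact: bmeas_cst|exact: expect_cst].
rewrite big_cons -IH; under eq_fun do rewrite big_cons.
by split; [exact: bmeasD|exact: expectD].
Qed.

Lemma ler_expect phi psi : bmeas phi -> bmeas psi -> (forall a, phi a <= psi a) ->
  expect phi <= expect psi.
Proof. by move=> b1 b2 h; apply: le_Rintegral => //; exact: bmeas_integrable. Qed.

Lemma expect_indic (C : set PlanM) : measurable C -> expect (\1_C) = fine (Pr C).
Proof. by move=> mC; rewrite /expect /Rintegral integral_indic// setIT. Qed.

Lemma expect_dist phi psi (e : R) : bmeas phi -> bmeas psi ->
  (forall a, `|phi a - psi a| <= e) -> `|expect phi - expect psi| <= e.
Proof.
move=> b1 b2 h; have h' a : - e <= phi a - psi a /\ phi a - psi a <= e.
  by have := h a; rewrite ler_norml => /andP.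
rewrite ler_norml lerBrDr lerBlDr -[X in X + _](expect_cst) -[X in _ <= X + _](expect_cst).
rewrite -!expectD; try exact: bmeas_cst; try by [].
apply/andP; split; apply: ler_expect => //; try (by apply: bmeasD => //; exact: bmeas_cst).
  by move=> a; rewrite -lerBrDr; exact: (h' a).1.
by move=> a; rewrite -lerBlDr; exact: (h' a).2.
Qed.

End Integral.

(** The law and the mean agree on indicators of patterns, which are clopen, and both are linear. *)
Lemma expect_law (P : plan M -> Prop) E (mE : mean P E) phi : fin_det phi ->
  expect (law_of_mean mE) phi = E phi.
Proof.
move=> /fin_det_expand[hs [c ->]].
have bi ys : bmeas (\1_(pattern hs ys)) by apply: bmeas_indic; exact: measurable_pattern.
rewrite expect_sum; last by move=> ys; exact: bmeasZ (bi ys).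
rewrite (mean_sum mE); last first.
  by move=> ys; exact: (bmeasZ (c ys) (bi ys)).2.
apply: eq_bigr => ys _; rewrite expectZ//.
rewrite expect_indic; last exact: measurable_pattern.
have -> : fine ((law_of_mean mE : probability PlanM R) (pattern hs ys)) = E (\1_(pattern hs ys)).
  by rewrite /= law_clopen//; exact: pattern_clopen.
have := mean_lin mE (c ys) 0 (bi ys).2 (bounded_cst _ 0).
rewrite !mul0r addr0 => <-; congr E; apply/funext => a.
by rewrite addr0.
Qed.

Section UniformLimit.
Variables (phi : plan M -> R) (F : nat -> plan M -> R) (e : nat -> R).
Hypothesis F_fin : forall n, fin_det (F n).
Hypothesis F_close : forall n a, `|phi a - F n a| <= e n.
Hypothesis e_cvg0 : e @ \oo --> 0.

Lemma bmeas_uniform_lim : bmeas phi.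
Proof.
have bF n := bmeas_fin_det (F_fin n).
apply: (bmeas_lim bF) => [|a].
  have [B hB] := (bF 0%N).2; exists (e 0%N + B) => a.
  by rewrite -[phi a](subrK (F 0%N a)) (le_trans (ler_normD _ _))// lerD.
apply/cvgrPdist_le => d d0; have [N _ hN] := @cvgr_le _ _ _ _ _ _ e_cvg0 d d0.
by exists N => // n Nn; rewrite (le_trans (F_close n a))// hN.
Qed.

(** A finitely additive [E] need not commute with pointwise limits, but it does with uniform ones;
    this reaches infinite discounted sums. *)
Lemma expect_law_lim (P : plan M -> Prop) E (mE : mean P E) :
  expect (law_of_mean mE) phi = E phi.
Proof.
have bphi := bmeas_uniform_lim.
apply/eqP; rewrite -subr_eq0 -normr_le0; apply/ler_addgt0Pr => d d0.
have d2 : 0 < d / 2 by rewrite divr_gt0.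
have [N _ /(_ N (leqnn N)) /= hN] := @cvgr_le _ _ _ _ _ _ e_cvg0 (d / 2) d2.
have bN := bmeas_fin_det (F_fin N).
rewrite add0r (_ : d = d / 2 + d / 2); last by field.
rewrite -[X in `|X - _|](subrK (expect (law_of_mean mE) (F N))) -addrA.
apply: le_trans (ler_normD _ _) _; apply: lerD; apply: le_trans hN.
  by apply: expect_dist => // a; exact: F_close.
rewrite expect_law// distrC; apply: (mean_dist mE); [exact: bphi.2|exact: bN.2|].
by move=> a; exact: F_close.
Qed.

End UniformLimit.
End PlanFunctions.

(** * Lagrangian, dual value and lotteries *)

Section Model.
Variables (R : realType) (M : model R).
Local Notation S := (St M).
Local Notation A := (Ac M).
Local Notation X := (Xs M).
Local Notation I := (nI M).
Local Notation pr := (trans_ M).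
Local Notation beta := (beta_ M).
Local Notation mult := (seq (S * A) -> 'I_I -> R).
Implicit Types (a : plan M) (x : X) (s : S) (w : seq S) (gam : 'I_I -> R) (lam : mult).

Hypothesis hpi : forall s s' : S, 0 < pr s s'.
Hypothesis hstoch : forall s : S, \sum_(s' : S) pr s s' = 1.
Hypothesis hr : bdd3 (rfun M).
Hypothesis hg : forall i, bdd3 (gfun M i).
Hypothesis hbeta : 0 < beta < 1.
Hypothesis hstand : forall x s, exists a, feasible x s a.

Let beta_gt0 : 0 < beta. Proof. by case/andP: hbeta. Qed.
Let beta_lt1 : beta < 1. Proof. by case/andP: hbeta. Qed.

(** * Expectations over shock histories, and continuations of plans *)

Lemma Eh0 s (h : seq S -> R) : Eh s 0 h = h [::].
Proof. by rewrite /Eh (big_tuple0 (fun w => pprob s w * h w)) mul1r. Qed.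

Lemma EhS s t (h : seq S -> R) :
  Eh s t.+1 h = \sum_(s' : S) pr s s' * Eh s' t (fun w => h (s' :: w)).
Proof.
rewrite /Eh (big_tupleS _ (fun w => pprob s w * h w)); apply: eq_bigr => s' _.
by rewrite mulr_sumr; apply: eq_bigr => w _; rewrite mulrA.
Qed.

Lemma EhD s t (h k : seq S -> R) : Eh s t (fun w => h w + k w) = Eh s t h + Eh s t k.
Proof. by rewrite /Eh -big_split; apply: eq_bigr => w _; rewrite mulrDr. Qed.

Lemma EhZ s t (c : R) (h : seq S -> R) : Eh s t (fun w => c * h w) = c * Eh s t h.
Proof. by rewrite /Eh mulr_sumr; apply: eq_bigr => w _; rewrite mulrCA. Qed.

Lemma Eh_sum s t (J : finType) (h : J -> seq S -> R) :
  Eh s t (fun w => \sum_j h j w) = \sum_j Eh s t (h j).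
Proof.
rewrite /Eh exchange_big /=; apply: eq_bigr => w _.
by rewrite mulr_sumr.
Qed.

Lemma pprob_gt0 s w : 0 < pprob s w.
Proof. by elim: w s => //= s' w IH s; rewrite mulr_gt0. Qed.

Lemma Eh_cst s t (c : R) : Eh s t (fun=> c) = c.
Proof.
elim: t s => [|t IH] s; first by rewrite Eh0.
rewrite EhS; under eq_bigr do rewrite IH.
by rewrite -mulr_suml hstoch mul1r.
Qed.

Lemma ler_Eh s t (h k : seq S -> R) : (forall w, h w <= k w) -> Eh s t h <= Eh s t k.
Proof. by move=> hk; apply: ler_sum => w _; rewrite ler_pM2l// pprob_gt0. Qed.

Lemma ler_norm_Eh s t (h : seq S -> R) : `|Eh s t h| <= Eh s t (fun w => `|h w|).
Proof.
apply: le_trans (ler_norm_sum _ _ _) _; apply: ler_sum => w _.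
by rewrite normrM gtr0_norm// pprob_gt0.
Qed.

Lemma Eh_le_cst s t (h : seq S -> R) c : (forall w, h w <= c) -> Eh s t h <= c.
Proof. by move=> hc; rewrite -[leRHS](Eh_cst s t); apply: ler_Eh. Qed.

Lemma norm_Eh_le s t (h : seq S -> R) c : (forall w, `|h w| <= c) -> `|Eh s t h| <= c.
Proof. by move=> hc; apply: le_trans (ler_norm_Eh _ _ _) _; apply: Eh_le_cst. Qed.

(* The continuation of a plan after the first period's shock [s0]; the next
   shock is the first component of the argument. *)
Definition after s0 a : plan M := fun h => a (s0, h.1 :: h.2).

Definition next_state a x s := zeta_ x (a (s, [::])) s.

Lemma state_aux_after a s0 s pre x w :
  state_aux a s0 (s :: pre) x w = state_aux (after s0 a) s pre x w.
Proof. by elim: w pre x => //= s' w IH pre x; rewrite IH. Qed.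

Lemma state_cons a x s0 s w :
  state a x s0 (s :: w) = state (after s0 a) (next_state a x s0) s w.
Proof. by rewrite /state /= state_aux_after. Qed.

Lemma fval_cons f a x s0 s w :
  fval f a x s0 (s :: w) = fval f (after s0 a) (next_state a x s0) s w.
Proof. by rewrite /fval state_cons. Qed.

Lemma cont_cons f a x s0 s w :
  cont f a x s0 (s :: w) = cont f (after s0 a) (next_state a x s0) s w.
Proof.
rewrite /cont; congr rser; apply/funext => n; congr (_ * _).
by apply: eq_bigr => w' _; rewrite cat_cons fval_cons.
Qed.

Lemma admissibleE a x s : admissible x s a <->
  0 <= pfun M x (a (s, [::])) s /\ forall s', admissible (next_state a x s) s' (after s a).
Proof.
split=> [adm|[adm0 adm] [|s' w]].
- split=> [|s' w]; first exact: (adm [::]).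
  by have := adm (s' :: w); rewrite state_cons.
- exact: adm0.
- by rewrite state_cons; exact: adm.
Qed.

(** Plans are indexed by every initial shock, but from [s] only the entries starting at [s] count;
    equality of functions would be too strong for gluing. *)
Definition agree s a a' := forall w, a (s, w) = a' (s, w).

Lemma agree_after s s' a a' : agree s a a' -> agree s' (after s a) (after s a').
Proof. by move=> e w; rewrite /after e. Qed.

Lemma agree_state s a a' x w : agree s a a' -> state a x s w = state a' x s w.
Proof.
move=> e; rewrite /state; move: [::] x.
by elim: w => //= s' w IH pre x; rewrite IH e.
Qed.

Lemma agree_fval s a a' x : agree s a a' -> forall f, fval f a x s = fval f a' x s.
Proof. by move=> e f; apply/funext => w; rewrite /fval (agree_state _ _ e) e. Qed.

Lemma agree_value s a a' x : agree s a a' -> forall f, value f a x s = value f a' x s.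
Proof. by move=> e f; rewrite /value (agree_fval _ e). Qed.

Lemma agree_admissible s a a' x : agree s a a' -> admissible x s a -> admissible x s a'.
Proof. by move=> e adm w; rewrite -(agree_state _ _ e) -e; exact: adm. Qed.

(** Each next shock has its own continuation plan, so near-optimal continuations can be chosen
    separately and glued. *)
Definition prepend (a0 : A) (b : S -> plan M) : plan M :=
  fun h => if h.2 is s :: w then b s (s, w) else a0.

Lemma agree_prepend s s' (a0 : A) (b : S -> plan M) : agree s' (after s (prepend a0 b)) (b s').
Proof. by []. Qed.

Lemma admissible_prepend x s (a0 : A) (b : S -> plan M) : 0 <= pfun M x a0 s ->
  (forall s', admissible (zeta_ x a0 s) s' (b s')) -> admissible x s (prepend a0 b).
Proof.
move=> h0 hb; apply/admissibleE; split=> // s'.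
by apply: agree_admissible (hb s') => w.
Qed.

(** * Discounted values of plans *)

Definition partial_value f a x s n := \sum_(t < n) beta ^+ t * Eh s t (fval f a x s).

Lemma partial_valueS f a x s n : partial_value f a x s n.+1 =
  f x (a (s, [::])) s +
  beta * \sum_(s' : S) pr s s' * partial_value f (after s a) (next_state a x s) s' n.
Proof.
rewrite /partial_value big_ord_recl expr0 mul1r Eh0; congr (_ + _).
under [in RHS]eq_bigr do rewrite mulr_sumr.
rewrite exchange_big /= mulr_sumr; apply: eq_bigr => t _.
rewrite exprS -mulrA EhS mulr_sumr; congr (_ * _).
apply: eq_bigr => s' _; rewrite mulrCA.
by congr (_ * (_ * Eh _ _ _)); apply/funext => w; rewrite fval_cons.
Qed.

Section Bounded.
Variables (f : X -> A -> S -> R) (C : R).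
Hypothesis fC : forall x (b : A) s, `|f x b s| <= C.

Let term_le a x s t : `|beta ^+ t * Eh s t (fval f a x s)| <= C * beta ^+ t.
Proof.
have bt : 0 <= beta ^+ t by rewrite exprn_ge0// ltW.
rewrite normrM (ger0_norm bt) mulrC ler_wpM2r//.
by apply: norm_Eh_le => w; exact: fC.
Qed.

Lemma cvg_value a x s : partial_value f a x s @ \oo --> value f a x s.
Proof. exact: cvg_rser (rser_geometric hbeta (term_le a x s)).1. Qed.

Lemma value_tail a x s n :
  `|value f a x s - partial_value f a x s n| <= C / (1 - beta) * beta ^+ n.
Proof. exact: (rser_geometric hbeta (term_le a x s)).2. Qed.

Lemma norm_value_le a x s : `|value f a x s| <= C / (1 - beta).
Proof. by have := value_tail a x s 0; rewrite /partial_value big_ord0 subr0 mulr1. Qed.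

Lemma valueE a x s : value f a x s = f x (a (s, [::])) s +
  beta * \sum_(s' : S) pr s s' * value f (after s a) (next_state a x s) s'.
Proof.
have lhs : (fun n => partial_value f a x s n.+1) @ \oo --> value f a x s.
  by rewrite (@cvg_shiftS _ (partial_value f a x s)); exact: cvg_value.
apply: (cvg_unique (@Rhausdorff R) lhs).
rewrite (_ : (fun n => partial_value f a x s n.+1) = fun n => f x (a (s, [::])) s +
  beta * \sum_(s' : S) pr s s' * partial_value f (after s a) (next_state a x s) s' n); last first.
  by apply/funext => n; rewrite partial_valueS.
apply: cvgD; first exact: cvg_cst.
apply: cvgM; first exact: cvg_cst.
apply: (cvg_sumr
  (f := fun s' n => pr s s' * partial_value f (after s a) (next_state a x s) s' n)) => s'.
apply: cvgM; [exact: cvg_cst|exact: cvg_value].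
Qed.

Lemma norm_cont_le a x s w : `|cont f a x s w| <= C / (1 - beta).
Proof.
elim: w s a x => [|s' w IH] s a x; first exact: norm_value_le.
by rewrite cont_cons.
Qed.

End Bounded.

Lemma norm_le_supn (f : X -> A -> S -> R) : bdd3 f -> forall x (b : A) s, `|f x b s| <= supn f.
Proof.
move=> [C fC] x b s; set E := range (fun xas : X * A * S => (`|f xas.1.1 xas.1.2 xas.2|)%:E).
have Ef : E (`|f x b s|)%:E by exists (x, b, s).
have le1 : ((`|f x b s|)%:E <= ereal_sup E)%E by exact: ereal_sup_ubound.
have le2 : (ereal_sup E <= C%:E)%E.
  by apply: ge_ereal_sup => _ [[[y c] s'] _ <-] /=; rewrite lee_fin.
rewrite -lee_fin fineK //; rewrite fin_numElt.
by rewrite (lt_le_trans _ le1) ?ltNyr// (le_lt_trans le2) ?ltry.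
Qed.

Lemma bdd3_rg gam : bdd3 (rg gam).
Proof.
have [Cr hCr] := hr; have [Cg hCg] := boolp.choice hg.
exists (Cr + \sum_i `|gam i| * Cg i) => x b s.
apply: le_trans (ler_normD _ _) _; apply: lerD => //.
apply: le_trans (ler_norm_sum _ _ _) _; apply: ler_sum => i _.
by rewrite normrM ler_wpM2l.
Qed.

Lemma value_rg gam a x s : value (rg gam) a x s =
  value (rfun M) a x s + \sum_i gam i * value (gfun M i) a x s.
Proof.
have [C hC] := bdd3_rg gam; have [Cr hCr] := hr; have [Cg hCg] := boolp.choice hg.
have lhs := @cvg_value _ _ hC a x s.
apply: (cvg_unique (@Rhausdorff R) lhs).
have -> : partial_value (rg gam) a x s = fun n => partial_value (rfun M) a x s n +
    \sum_i gam i * partial_value (gfun M i) a x s n.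
  apply/funext => n; rewrite /partial_value.
  rewrite (eq_bigr (fun i => \sum_(t < n) beta ^+ t * Eh s t
    (fun w => gam i * fval (gfun M i) a x s w))).
    rewrite exchange_big -big_split /=; apply: eq_bigr => t _.
    by rewrite -mulr_sumr -mulrDr -Eh_sum -EhD.
  by move=> i _; rewrite mulr_sumr; apply: eq_bigr => t _; rewrite EhZ mulrCA.
apply: cvgD; first exact: (cvg_value hCr).
apply: (cvg_sumr (f := fun i n => gam i * partial_value (gfun M i) a x s n)) => i.
apply: cvgM; [exact: cvg_cst|exact: (cvg_value (hCg i))].
Qed.

(** Transition probabilities sum to one, so an error [e] in the continuation is discounted to
    [beta * e]. The case [e = 0] is monotonicity and is used repeatedly. *)
Lemma ler_bellman_rhs (F G : ('I_I -> R) -> X -> S -> R) gam x s (b : A) l e :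
  (forall s', F (fun i => gam i + l i) (zeta_ x b s) s' <=
              G (fun i => gam i + l i) (zeta_ x b s) s' + e) ->
  bellman_rhs F gam x s b l <= bellman_rhs G gam x s b l + beta * e.
Proof.
move=> FG; rewrite /bellman_rhs -[leRHS]addrA lerD2l -mulrDr ler_pM2l//.
rewrite -[e]mul1r -(hstoch s) mulr_suml -big_split /=; apply: ler_sum => s' _.
by rewrite -mulrDr ler_pM2l.
Qed.

(** * The finite-horizon Lagrangian *)

Definition shift_mult s (b : A) lam : mult := fun h => lam ((s, b) :: h).

(* The Lagrangian with multipliers on the first [T] periods only, unfolded one
   period at a time: past multipliers are moved into the weights [gam]. *)
Fixpoint lagr T gam x s a lam : R :=
  if T is T'.+1 then
    bellman_rhs (fun gam' x' s' => lagr T' gam' x' s' (after s a) (shift_mult s (a (s, [::])) lam))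
      gam x s (a (s, [::])) (lam [:: (s, a (s, [::]))])
  else value (rg gam) a x s.

Lemma lagrS T gam x s a lam : lagr T.+1 gam x s a lam =
  bellman_rhs (fun gam' x' s' => lagr T gam' x' s' (after s a) (shift_mult s (a (s, [::])) lam))
      gam x s (a (s, [::])) (lam [:: (s, a (s, [::]))]).
Proof. by []. Qed.

Definition slack lam a x s w :=
  \sum_i lam (posthist a s w) i * (cont (gfun M i) a x s w - gbar_ M i).

Definition penalty T lam a x s := \sum_(t < T) beta ^+ t * Eh s t (slack lam a x s).

Lemma posthist_cons a s0 s w :
  posthist a s0 (s :: w) = (s0, a (s0, [::])) :: posthist (after s0 a) s w.
Proof.
rewrite /posthist -[iota 0 (size (s :: w)).+1]/(0%N :: iota (1 + 0) (size w).+1).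
rewrite map_cons iotaDl -map_comp; congr (_ :: _); apply/eq_in_map => k.
rewrite mem_iota add0n => /andP[_ kw] /=.
by rewrite (set_nth_default s).
Qed.

Lemma slack_cons lam a x s0 s w : slack lam a x s0 (s :: w) =
  slack (shift_mult s0 (a (s0, [::])) lam) (after s0 a) (next_state a x s0) s w.
Proof.
rewrite /slack posthist_cons; apply: eq_bigr => i _.
by rewrite cont_cons.
Qed.

Lemma penaltyS T lam a x s : penalty T.+1 lam a x s =
  \sum_i lam [:: (s, a (s, [::]))] i * (value (gfun M i) a x s - gbar_ M i) +
  beta * \sum_s' pr s s' *
    penalty T (shift_mult s (a (s, [::])) lam) (after s a) (next_state a x s) s'.
Proof.
rewrite /penalty big_ord_recl expr0 mul1r Eh0; congr (_ + _).
under [in RHS]eq_bigr do rewrite mulr_sumr.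
rewrite exchange_big /= mulr_sumr; apply: eq_bigr => t _.
rewrite exprS -mulrA EhS mulr_sumr; congr (_ * _).
apply: eq_bigr => s' _; rewrite mulrCA.
by congr (_ * (_ * Eh _ _ _)); apply/funext => w; rewrite slack_cons.
Qed.

Lemma valueE_rg gam a x s : value (rg gam) a x s = rg gam x (a (s, [::])) s +
  beta * \sum_s' pr s s' * value (rg gam) (after s a) (next_state a x s) s'.
Proof. by have [C hC] := bdd3_rg gam; exact: (valueE hC). Qed.

Lemma valueE_g i a x s : value (gfun M i) a x s = gfun M i x (a (s, [::])) s +
  beta * \sum_s' pr s s' * value (gfun M i) (after s a) (next_state a x s) s'.
Proof. by have [C hC] := hg i; exact: (valueE hC). Qed.

Lemma value_rgD gam l a x s : value (rg (fun i => gam i + l i)) a x s =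
  value (rg gam) a x s + \sum_i l i * value (gfun M i) a x s.
Proof.
rewrite !value_rg -addrA -big_split; congr (_ + _).
by apply: eq_bigr => i _; rewrite mulrDl.
Qed.

(** A multiplier [l] weighs the whole discounted sum of [g] from its period on. The current term
    stays explicit in [bellman_rhs], and the remainder is what adding [l] to the weights contributes
    to the continuation value. *)
Lemma lagrE T gam x s a lam :
  lagr T gam x s a lam = value (rg gam) a x s + penalty T lam a x s.
Proof.
elim: T gam x s a lam => [|T IH] gam x s a lam.
  by rewrite /penalty big_ord0 addr0.
rewrite lagrS /bellman_rhs penaltyS valueE_rg /rg big_split /=.
set b := a (s, [::]); set l := lam [:: (s, b)].
(* The continuation splits into the value at the old weights, the contribution of [l], and the later
   penalties. *)
have -> : \sum_s' pr s s' * lagr T (fun i => gam i + l i) (zeta_ x b s) s' (after s a)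
      (shift_mult s b lam) =
    \sum_s' pr s s' * value (rg gam) (after s a) (next_state a x s) s' +
    (\sum_i l i * (\sum_s' pr s s' * value (gfun M i) (after s a) (next_state a x s) s') +
    \sum_s' pr s s' * penalty T (shift_mult s b lam) (after s a) (next_state a x s) s').
  rewrite (eq_bigr (fun i => \sum_s' pr s s' *
      (l i * value (gfun M i) (after s a) (next_state a x s) s'))); last first.
    by move=> i _; rewrite mulr_sumr; apply: eq_bigr => s' _; rewrite mulrCA.
  rewrite exchange_big -!big_split /=; apply: eq_bigr => s' _.
  by rewrite IH value_rgD -mulr_sumr -!mulrDr addrA.
have -> : \sum_i l i * (value (gfun M i) a x s - gbar_ M i) =
    \sum_i l i * (gfun M i x b s - gbar_ M i) + beta *
    \sum_i l i * (\sum_s' pr s s' * value (gfun M i) (after s a) (next_state a x s) s').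
  rewrite mulr_sumr -big_split; apply: eq_bigr => i _ /=.
  by rewrite valueE_g; ring.
ring.
Qed.

Definition nonneg_mult lam := forall h i, 0 <= lam h i.

Lemma lagr_agree T gam x s a a' lam :
  agree s a a' -> lagr T gam x s a lam = lagr T gam x s a' lam.
Proof.
elim: T gam x s a a' lam => [|T IH] gam x s a a' lam e; first exact: agree_value.
rewrite !lagrS (e [::]); congr bellman_rhs.
apply/funext => gam'; apply/funext => x'; apply/funext => s'.
exact/IH/agree_after.
Qed.

Lemma lagr_eq_mult T gam x s a lam lam' :
  (forall b h, lam ((s, b) :: h) = lam' ((s, b) :: h)) ->
  lagr T gam x s a lam = lagr T gam x s a lam'.
Proof.
move=> e; rewrite !lagrE /penalty; congr (_ + _); apply: eq_bigr => t _.
congr (_ * Eh _ _ _); apply/funext => w; apply: eq_bigr => i _.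
by rewrite /posthist /= e.
Qed.

Lemma lagr_zero T gam x s a lam : (forall p h i, lam (p :: h) i = 0) ->
  lagr T gam x s a lam = value (rg gam) a x s.
Proof.
move=> l0; rewrite lagrE /penalty big1 ?addr0// => t _.
rewrite (_ : slack _ _ _ _ = fun=> 0) ?Eh_cst ?mulr0//.
by apply/funext => w; apply: big1 => i _; rewrite /posthist /= l0 mul0r.
Qed.

(** A post-action history of period [t] has [t + 1] entries, so [size h <= T] keeps exactly the
    periods before [T]. *)
Definition cutoff T lam : mult := fun h i => if (size h <= T)%N then lam h i else 0.

Lemma cutoff_ge0 T lam : nonneg_mult lam -> nonneg_mult (cutoff T lam).
Proof. by move=> l0 h i; rewrite /cutoff; case: ifP. Qed.

Lemma lagr_cutoff T T' gam x s a lam : (T <= T')%N ->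
  lagr T' gam x s a (cutoff T lam) = lagr T gam x s a lam.
Proof.
elim: T T' gam x s a lam => [|T IH] T' gam x s a lam; first by move=> _; rewrite lagr_zero.
case: T' => // T' TT'; rewrite !lagrS; congr bellman_rhs.
apply/funext => gam'; apply/funext => x'; apply/funext => s'.
by rewrite -(IH T').
Qed.

Lemma lagr_ge T gam x s a lam : feasible x s a -> nonneg_mult lam ->
  value (rg gam) a x s <= lagr T gam x s a lam.
Proof.
move=> [_ fa] l0; rewrite lagrE lerDl; apply: sumr_ge0 => t _.
rewrite mulr_ge0 ?exprn_ge0 ?(ltW beta_gt0)//; apply: sumr_ge0 => w _.
rewrite mulr_ge0//; first exact/ltW/pprob_gt0.
by apply: sumr_ge0 => i _; rewrite mulr_ge0// subr_ge0.
Qed.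

(** By induction on the horizon: only finitely many pairs of first action and next shock occur, so
    the continuation bounds combine into one valid for all plans. *)
Lemma lagr_bounded T gam x s lam : exists B, forall a, lagr T gam x s a lam <= B.
Proof.
elim: T gam x s lam => [|T IH] gam x s lam.
  have [C hC] := bdd3_rg gam; exists (C / (1 - beta)) => a.
  exact: le_trans (ler_norm _) (norm_value_le hC _ _ _).
pose l b := lam [:: (s, b)].
have /boolp.choice[B hB] : forall p : A * S, exists B, forall a,
    lagr T (fun i => gam i + l p.1 i) (zeta_ x p.1 s) p.2 a (shift_mult s p.1 lam) <= B.
  by move=> p; exact: IH.
pose F b := bellman_rhs (fun _ _ s' => B (b, s')) gam x s b (l b).
exists (\sum_b `|F b|) => a; set b := a (s, [::]).
apply: (@le_trans _ _ (F b)).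
  rewrite lagrS -[leRHS]addr0 -(mulr0 beta); apply: ler_bellman_rhs => // s'.
  by rewrite addr0; exact: (hB (b, s')).
rewrite (bigD1 b)//=; apply: le_trans (ler_norm _) _.
by rewrite lerDl sumr_ge0.
Qed.

(** * Suprema of the Lagrangian over admissible plans *)

Definition lagr_sup T gam x s lam :=
  sup [set lagr T gam x s a lam | a in [set a | admissible x s a]].

Lemma has_sup_lagr T gam x s lam :
  has_sup [set lagr T gam x s a lam | a in [set a | admissible x s a]].
Proof.
split.
  by have [a [adm _]] := hstand x s; exists (lagr T gam x s a lam), a.
by have [B hB] := lagr_bounded T gam x s lam; exists B => _ [a _ <-].
Qed.

Lemma lagr_sup_ub T gam x s a lam : admissible x s a ->
  lagr T gam x s a lam <= lagr_sup T gam x s lam.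
Proof. by move=> adm; apply: (sup_upper_bound (has_sup_lagr T gam x s lam)); exists a. Qed.

Lemma lagr_sup_approx T gam x s lam e : 0 < e ->
  exists2 a, admissible x s a & lagr_sup T gam x s lam - e < lagr T gam x s a lam.
Proof.
move=> e0; have [_ [a adm <-] h] := sup_adherent e0 (has_sup_lagr T gam x s lam).
by exists a.
Qed.

Lemma lagr_sup_le T gam x s lam c : (forall a, admissible x s a ->
  lagr T gam x s a lam <= c) -> lagr_sup T gam x s lam <= c.
Proof.
move=> hc; apply: ge_sup; first exact: (has_sup_lagr T gam x s lam).1.
by move=> _ [a adm <-]; exact: hc.
Qed.

(** Prepending [b] to plans that are [e]-optimal after each next shock loses at most [beta * e]. *)
Lemma lagr_supS_ge T gam x s lam b : 0 <= pfun M x b s ->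
  bellman_rhs (fun gam' x' s' => lagr_sup T gam' x' s' (shift_mult s b lam))
    gam x s b (lam [:: (s, b)]) <= lagr_sup T.+1 gam x s lam.
Proof.
move=> pb; apply/ler_addgt0Pr => e e0.
have /boolp.choice[c hc] : forall s', exists a, admissible (zeta_ x b s) s' a /\
    lagr_sup T (fun i => gam i + lam [:: (s, b)] i) (zeta_ x b s) s' (shift_mult s b lam) - e <
    lagr T (fun i => gam i + lam [:: (s, b)] i) (zeta_ x b s) s' a (shift_mult s b lam).
  move=> s'; have [a adm h] := lagr_sup_approx T (fun i => gam i + lam [:: (s, b)] i)
    (zeta_ x b s) s' (shift_mult s b lam) e0.
  by exists a.
have adm : admissible x s (prepend b c) by apply: admissible_prepend => // s'; exact: (hc s').1.
apply: le_trans (lerD (lagr_sup_ub T.+1 gam lam adm) (lexx e)).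
rewrite lagrS; apply: (@le_trans _ _ (bellman_rhs (fun gam' x' s' =>
  lagr T gam' x' s' (c s') (shift_mult s b lam)) gam x s b (lam [:: (s, b)]) + beta * e)).
  apply: ler_bellman_rhs => // s'.
  by rewrite -lerBlDr ltW// (hc s').2.
apply: lerD; last by rewrite -[leRHS]mul1r ler_wpM2r// ltW.
rewrite -[leRHS]addr0 -(mulr0 beta); apply: ler_bellman_rhs => // s'.
by rewrite addr0 -(lagr_agree _ _ _ _ (@agree_prepend s s' b c)).
Qed.

(** If every admissible first action fell short, finiteness would make the shortfall uniform and put
    the supremum below itself. *)
Lemma lagr_supS_le T gam x s lam : exists2 b, 0 <= pfun M x b s &
  lagr_sup T.+1 gam x s lam <=
  bellman_rhs (fun gam' x' s' => lagr_sup T gam' x' s' (shift_mult s b lam))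
    gam x s b (lam [:: (s, b)]).
Proof.
apply: contrapT => H.
pose v b := bellman_rhs (fun gam' x' s' => lagr_sup T gam' x' s' (shift_mult s b lam))
  gam x s b (lam [:: (s, b)]).
have [b pb|e e0 he] := @finite_gap R A (fun b => 0 <= pfun M x b s) v
    (lagr_sup T.+1 gam x s lam).
  by rewrite ltNge; apply/negP => h; apply: H; exists b.
suff : lagr_sup T.+1 gam x s lam <= lagr_sup T.+1 gam x s lam - e.
  by rewrite lerBrDr -lerBrDl subrr leNgt e0.
apply: lagr_sup_le => a /admissibleE[p0 adm].
apply: le_trans (he _ p0); rewrite lagrS -[leRHS]addr0 -(mulr0 beta).
apply: ler_bellman_rhs => // s'.
by rewrite addr0; exact: lagr_sup_ub.
Qed.

Lemma lagr_sup_cutoff T T' gam x s lam : (T <= T')%N ->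
  lagr_sup T' gam x s (cutoff T lam) = lagr_sup T gam x s lam.
Proof.
move=> TT'; congr (sup (_ @` _)); apply/funext => a.
exact: lagr_cutoff.
Qed.

(** * The dual value and its recursion *)

(** The infimum runs over finite-horizon multipliers and is a real number; [Dt_dual] identifies it
    with [Dt]. *)
Definition dual gam x s :=
  inf [set v | exists T lam, nonneg_mult lam /\ lagr_sup T gam x s lam = v].

Lemma has_inf_dual gam x s :
  has_inf [set v | exists T lam, nonneg_mult lam /\ lagr_sup T gam x s lam = v].
Proof.
split.
  by exists (lagr_sup 0 gam x s (fun _ _ => 0)), 0%N, (fun _ _ => 0); split.
have [a fa] := hstand x s; exists (value (rg gam) a x s) => _ [T [lam [l0 <-]]].
exact: le_trans (lagr_ge T gam fa l0) (lagr_sup_ub _ _ _ fa.1).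
Qed.

Lemma dual_le T gam x s lam : nonneg_mult lam -> dual gam x s <= lagr_sup T gam x s lam.
Proof. by move=> l0; apply: ge_inf; [exact: (has_inf_dual _ _ _).2|exists T, lam]. Qed.

Lemma dual_ge gam x s c : (forall T lam, nonneg_mult lam ->
  c <= lagr_sup T gam x s lam) -> c <= dual gam x s.
Proof.
move=> hc; apply: lb_le_inf; first exact: (has_inf_dual _ _ _).1.
by move=> _ [T [lam [l0 <-]]]; exact: hc.
Qed.

(** Every later horizon is allowed so that finitely many problems can be approximated at a common
    one. *)
Lemma dual_approx gam x s e : 0 < e -> exists T, forall T', (T <= T')%N ->
  exists2 lam, nonneg_mult lam & lagr_sup T' gam x s lam < dual gam x s + e.
Proof.
move=> e0; have [_ [T [lam [l0 <-]]] h] := inf_adherent e0 (has_inf_dual gam x s).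
exists T => T' TT'; exists (cutoff T lam); first exact: cutoff_ge0.
by rewrite lagr_sup_cutoff.
Qed.

(** A near-optimal multiplier supplies [l] through its value at the one-entry history [(s, b)]; its
    shift is a competitor in each continuation problem. *)
Lemma bellman_dual_le gam x s b e : 0 <= pfun M x b s -> 0 < e ->
  exists2 l, nonneg l & bellman_rhs dual gam x s b l <= dual gam x s + e.
Proof.
move=> pb e0; have [T /(_ T.+1 (leqnSn T))[lam l0 /ltW hl]] := dual_approx gam x s e0.
exists (lam [:: (s, b)]); first exact: l0.
apply: le_trans hl; apply: le_trans (lagr_supS_ge T gam lam pb).
rewrite -[leRHS]addr0 -(mulr0 beta); apply: ler_bellman_rhs => // s'.
by rewrite addr0; apply: dual_le => h i; exact: l0.
Qed.

(** Otherwise each admissible action [b] has some [l b] pushing the right-hand side below the dual.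
    Because histories record the first action, these choices and near-optimal continuation
    multipliers form a single multiplier that beats the dual value. *)
Lemma bellman_dual_ge gam x s : exists2 b, 0 <= pfun M x b s &
  forall l, nonneg l -> dual gam x s <= bellman_rhs dual gam x s b l.
Proof.
apply: contrapT => H.
have /boolp.choice[l hl] : forall b, exists l, nonneg l /\
    (0 <= pfun M x b s -> bellman_rhs dual gam x s b l < dual gam x s).
  move=> b; apply: contrapT => Hb; apply: H; exists b.
    by apply: contrapT => npb; apply: Hb; exists (fun=> 0); split.
  move=> l l0; rewrite leNgt; apply/negP => h; apply: Hb.
  by exists l; split.
have [e e0 he] := @finite_gap R A (fun b => 0 <= pfun M x b s) _ _ (fun b => (hl b).2).
have /boolp.choice[T hT] : forall p : A * S, exists T, forall T', (T <= T')%N ->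
    exists2 lam, nonneg_mult lam &
    lagr_sup T' (fun i => gam i + l p.1 i) (zeta_ x p.1 s) p.2 lam <
    dual (fun i => gam i + l p.1 i) (zeta_ x p.1 s) p.2 + e.
  by move=> p; exact: dual_approx.
pose N := \max_p T p.
have /boolp.choice[lam hlam] : forall p : A * S, exists lam, nonneg_mult lam /\
    lagr_sup N (fun i => gam i + l p.1 i) (zeta_ x p.1 s) p.2 lam <
    dual (fun i => gam i + l p.1 i) (zeta_ x p.1 s) p.2 + e.
  by move=> p; have [|L L0 h] := hT p N; [exact: leq_bigmax|exists L; split].
(* A one-entry history uses the multiplier of its action; a longer one is routed by first action and
   second shock to the continuation multiplier, evaluated at the tail [h']. *)
pose L : mult := fun h i =>
  match h with
  | [::] => 0
  | [:: p] => l p.2 i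
  | p :: (q :: _) as h' => lam (p.2, q.1) h' i
  end.
have L0 : nonneg_mult L.
  by move=> [|p [|q h]] i //=; [exact: (hl _).1|exact: (hlam _).1].
have [b pb hb] := lagr_supS_le N gam x s L.
have := dual_le N.+1 gam x s L0; rewrite leNgt => /negP; apply.
apply: le_lt_trans hb _.
apply: (@le_lt_trans _ _ (bellman_rhs dual gam x s b (l b) + beta * e)).
  apply: ler_bellman_rhs => // s'; apply: le_trans (ltW (hlam (b, s')).2).
  rewrite /lagr_sup le_eqVlt; apply/orP; left; apply/eqP.
  by congr (sup (_ @` _)); apply/funext => a; exact: lagr_eq_mult.
(* The margin [e] outweighs the discounted continuation error [beta * e]. *)
apply: (@le_lt_trans _ _ (dual gam x s - e + beta * e)); first by rewrite lerD2r he.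
by rewrite -addrA gtrDl addrC -{2}[e]mul1r -mulrBl pmulr_llt0// subr_lt0.
Qed.

(** * Bounds, convexity and Lipschitz continuity of the dual value *)

Lemma norm_value_rg_le gam a x s : nonneg gam ->
  `|value (rg gam) a x s| <= (1 + \sum_i gam i) * Lconst M.
Proof.
move=> g0; have b1 : 0 <= (1 - beta)^-1 by rewrite invr_ge0 subr_ge0 ltW.
have sr0 : 0 <= supn (rfun M) := le_trans (normr_ge0 _) (norm_le_supn hr x (a_pt M) s).
have sg0 i : 0 <= supn (gfun M i) := le_trans (normr_ge0 _) (norm_le_supn (hg i) x (a_pt M) s).
rewrite value_rg// mulrDl mul1r mulr_suml.
apply: le_trans (ler_normD _ _) _; apply: lerD.
  apply: le_trans (norm_value_le (norm_le_supn hr) _ _ _) _.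
  by rewrite ler_wpM2r// lerDl sumr_ge0.
apply: le_trans (ler_norm_sum _ _ _) _; apply: ler_sum => i _.
rewrite normrM ger0_norm// ler_wpM2l//.
apply: le_trans (norm_value_le (norm_le_supn (hg i)) _ _ _) _.
rewrite ler_wpM2r// (bigD1 i)//= addrCA lerDl addr_ge0// sumr_ge0//.
Qed.

Lemma dual_ge_value gam x s a : feasible x s a -> value (rg gam) a x s <= dual gam x s.
Proof.
move=> fa; apply: dual_ge => T lam l0.
apply: le_trans (lagr_ge T gam fa l0) _.
exact: (lagr_sup_ub _ _ _ fa.1).
Qed.

Lemma dual_le_Lconst gam x s : nonneg gam -> dual gam x s <= (1 + \sum_i gam i) * Lconst M.
Proof.
move=> g0; apply: le_trans (dual_le 0 gam x s (fun _ _ => lexx 0)) _.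
apply: lagr_sup_le => // a _ /=.
exact: le_trans (ler_norm _) (norm_value_rg_le _ _ _ g0).
Qed.

Lemma norm_dual_le gam x s : nonneg gam -> `|dual gam x s| <= (1 + \sum_i gam i) * Lconst M.
Proof.
move=> g0; rewrite ler_norml dual_le_Lconst// andbT.
have [a fa] := hstand x s; apply: le_trans (dual_ge_value gam fa).
by have := norm_value_rg_le a x s g0; rewrite ler_norml => /andP[].
Qed.

(** Joint affinity in weights and multipliers makes the supremum over plans jointly convex, and
    minimising over the multipliers then preserves convexity in the weights. *)
Lemma lagr_affine T (t : R) g1 g2 x s a lam1 lam2 :
  lagr T (fun i => t * g1 i + (1 - t) * g2 i) x s a
    (fun h i => t * lam1 h i + (1 - t) * lam2 h i) =
  t * lagr T g1 x s a lam1 + (1 - t) * lagr T g2 x s a lam2.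
Proof.
have -> : lagr T (fun i => t * g1 i + (1 - t) * g2 i) x s a
    (fun h i => t * lam1 h i + (1 - t) * lam2 h i) =
  value (rfun M) a x s + (t * (\sum_i g1 i * value (gfun M i) a x s) +
     (1 - t) * (\sum_i g2 i * value (gfun M i) a x s)) +
  (t * penalty T lam1 a x s + (1 - t) * penalty T lam2 a x s).
  rewrite lagrE value_rg//; congr (_ + _ + _).
    by rewrite !mulr_sumr -big_split; apply: eq_bigr => i _ /=; rewrite mulrDl !mulrA.
  rewrite /penalty !mulr_sumr -big_split; apply: eq_bigr => k _ /=.
  rewrite (_ : slack _ a x s = fun w => t * slack lam1 a x s w + (1 - t) * slack lam2 a x s w).
    by rewrite EhD !EhZ; ring.
  apply/funext => w; rewrite /slack !mulr_sumr -big_split; apply: eq_bigr => i _ /=.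
  by rewrite mulrDl !mulrA.
by rewrite !lagrE !value_rg//; ring.
Qed.

Lemma dual_convex x s g1 g2 (t : R) : 0 <= t <= 1 ->
  dual (fun i => t * g1 i + (1 - t) * g2 i) x s <= t * dual g1 x s + (1 - t) * dual g2 x s.
Proof.
move=> /andP[t0 t1]; have t1' : 0 <= 1 - t by rewrite subr_ge0.
apply/ler_addgt0Pr => e e0.
have [T1 hT1] := dual_approx g1 x s e0.
have [T2 hT2] := dual_approx g2 x s e0.
have [lam1 l1 /ltW h1] := hT1 _ (leq_maxl T1 T2).
have [lam2 l2 /ltW h2] := hT2 _ (leq_maxr T1 T2).
have l0 : nonneg_mult (fun h i => t * lam1 h i + (1 - t) * lam2 h i).
  by move=> h i; rewrite addr_ge0 ?mulr_ge0.
apply: le_trans (dual_le (maxn T1 T2) _ _ _ l0) _.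
apply: lagr_sup_le => // a adm; rewrite lagr_affine.
have -> : t * dual g1 x s + (1 - t) * dual g2 x s + e =
  t * (dual g1 x s + e) + (1 - t) * (dual g2 x s + e) by ring.
apply: lerD; apply: ler_wpM2l => //.
  by apply: le_trans h1; exact: lagr_sup_ub.
by apply: le_trans h2; exact: lagr_sup_ub.
Qed.

(** The same multiplier is used for both weights: the penalties cancel for each plan, leaving values
    of [g] that are bounded by [Lconst]. *)
Lemma dual_lipschitz x s g1 g2 :
  `|dual g1 x s - dual g2 x s| <= Lconst M * \sum_i `|g1 i - g2 i|.
Proof.
have half h1 h2 : dual h1 x s - dual h2 x s <= Lconst M * \sum_i `|h1 i - h2 i|.
  rewrite lerBlDr -lerBlDl; apply: dual_ge => T lam l0; rewrite lerBlDl.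
  apply: le_trans (dual_le T h1 x s l0) _; apply: lagr_sup_le => // a adm.
  apply: (@le_trans _ _ (Lconst M * (\sum_i `|h1 i - h2 i|) + lagr T h2 x s a lam)).
    have -> : lagr T h1 x s a lam =
        (\sum_i (h1 i - h2 i) * value (gfun M i) a x s) + lagr T h2 x s a lam.
      rewrite !lagrE !value_rg//.
      under [X in _ = X + _]eq_bigr do rewrite mulrBl.
      by rewrite sumrB; ring.
    rewrite lerD2r mulr_sumr; apply: ler_sum => i _.
    apply: le_trans (ler_norm _) _; rewrite normrM mulrC ler_wpM2r//.
    apply: le_trans (norm_value_le (norm_le_supn (hg i)) _ _ _) _.
    rewrite ler_wpM2r ?invr_ge0 ?subr_ge0 ?(ltW beta_lt1)//.
    rewrite (bigD1 i)//= addrCA lerDl addr_ge0 ?sumr_ge0//.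
      exact: le_trans (normr_ge0 _) (norm_le_supn hr x (a_pt M) s).
    by move=> j _; exact: le_trans (normr_ge0 _) (norm_le_supn (hg j) x (a_pt M) s).
  by rewrite lerD2l; exact: lagr_sup_ub.
rewrite ler_norml half andbT lerNl opprB.
by under eq_bigr do rewrite distrC; exact: half.
Qed.

(** * The functional equation and maximality of the dual value *)

Lemma bellman_dual : bellman dual.
Proof.
move=> gam x s g0; apply/eqP; rewrite eq_le; apply/andP; split.
  have [b pb hb] := bellman_dual_ge gam x s.
  apply: (@le_trans _ _ (ereal_inf [set (bellman_rhs dual gam x s b l)%:E
      | l in [set l | nonneg l]])).
    by apply: le_ereal_inf_tmp => _ [l l0 <-]; rewrite lee_fin hb.
  by apply: ereal_sup_ubound; exists b.
apply: ge_ereal_sup => _ [b pb <-].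
apply/lee_addgt0Pr => e e0.
have [l l0 hl] := bellman_dual_le gam pb e0.
apply: (@le_trans _ _ (bellman_rhs dual gam x s b l)%:E).
  by apply: ereal_inf_lbound; exists l.
by rewrite -EFinD lee_fin.
Qed.

Lemma bellman_maximizer (F : ('I_I -> R) -> X -> S -> R) gam x s :
  bellman F -> nonneg gam -> exists2 b, 0 <= pfun M x b s &
  forall l, nonneg l -> F gam x s <= bellman_rhs F gam x s b l.
Proof.
move=> hF g0; apply: contrapT => H.
have /boolp.choice[l hl] : forall b, exists l, nonneg l /\
    (0 <= pfun M x b s -> bellman_rhs F gam x s b l < F gam x s).
  move=> b; apply: contrapT => Hb; apply: H; exists b.
    by apply: contrapT => npb; apply: Hb; exists (fun=> 0); split.
  move=> l l0; rewrite leNgt; apply/negP => h; apply: Hb.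
  by exists l; split.
have [e e0 he] := @finite_gap R A (fun b => 0 <= pfun M x b s) _ _ (fun b => (hl b).2).
suff : ((F gam x s)%:E <= (F gam x s - e)%:E)%E.
  by rewrite lee_fin lerBrDr -lerBrDl subrr leNgt e0.
rewrite {1}(hF _ _ _ g0); apply: ge_ereal_sup => _ [b pb <-].
apply: (@le_trans _ _ (bellman_rhs F gam x s b (l b))%:E).
  by apply: ereal_inf_lbound; exists (l b) => //; exact: (hl b).1.
by rewrite lee_fin he.
Qed.

(* Iterating the Bellman inequality with zero multipliers: the terminal term is
   discounted away because [F] and the value of a plan grow at most linearly in
   the unchanged weights [gam]. *)
Lemma bellman_le_value (F : ('I_I -> R) -> X -> S -> R) gam x s :
  inN F -> bellman F -> nonneg gam ->
  F gam x s <= lagr_sup 0 gam x s (fun _ _ => 0).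
Proof.
move=> [_ [_ [_ [_ Fub]]]] hF g0; pose Z : mult := fun _ _ => 0.
pose C := (1 + \sum_i gam i) * Lconst M.
have lagrZ T x' s' : lagr_sup T gam x' s' Z = lagr_sup 0 gam x' s' Z.
  congr (sup (_ @` _)); apply/funext => a.
  by rewrite lagr_zero.
(* The constant [C + C] comes from [n = 0]: [F] is at most [C], while the supremum is at least
   [- C]. *)
have step n x' s' : F gam x' s' <= lagr_sup 0 gam x' s' Z + (C + C) * beta ^+ n.
  elim: n x' s' => [|n IH] x' s'.
    rewrite expr0 mulr1 -lerBlDl; apply: le_trans (lerB (Fub x' s' gam g0) _) _.
      have [a [adm _]] := hstand x' s'.
      apply: le_trans (lagr_sup_ub 0 gam Z adm).
      have := norm_value_rg_le a x' s' g0; rewrite ler_norml => /andP[h _].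
      exact: h.
    by rewrite opprK.
  have [b pb hb] := bellman_maximizer x' s' hF g0.
  apply: le_trans (hb (fun=> 0) (fun=> lexx 0)) _.
  rewrite -(lagrZ 1%N) exprS [_ * (beta * _)]mulrCA.
  have := lagr_supS_ge 0 gam Z pb.
  rewrite -(lerD2r (beta * ((C + C) * beta ^+ n))).
  apply: le_trans; apply: ler_bellman_rhs => // y.
  rewrite (_ : (fun i => gam i + 0) = gam) ?IH//.
  by apply/funext => i; rewrite addr0.
apply/ler_addgt0Pr => e e0.
have c0 : (fun n => lagr_sup 0 gam x s Z + (C + C) * beta ^+ n) @ \oo -->
    lagr_sup 0 gam x s Z + 0.
  apply: cvgD; first exact: cvg_cst.
  by apply: (@cvg_geometric R (C + C) beta); rewrite gtr0_norm.
rewrite addr0 in c0.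
apply: le_trans (_ : lagr_sup 0 gam x s Z <= _); last by rewrite lerDl ltW.
by apply: (cvg_lower c0) => n; exact: step.
Qed.

(** At a maximising action the inner infimum is bounded by the choice [lam [:: (s, b)]], so each
    step consumes one period of the multiplier until none is left. *)
Lemma bellman_le_dual (F : ('I_I -> R) -> X -> S -> R) gam x s :
  inN F -> bellman F -> nonneg gam -> F gam x s <= dual gam x s.
Proof.
move=> NF hF g0; apply: dual_ge => T lam l0.
elim: T gam x s lam g0 l0 => [|T IH] gam x s lam g0 l0; first exact: bellman_le_value.
have [b pb hb] := bellman_maximizer x s hF g0.
apply: le_trans (hb (lam [:: (s, b)]) (l0 _)) _.
apply: le_trans (lagr_supS_ge T gam lam pb).
rewrite -[leRHS]addr0 -(mulr0 beta); apply: ler_bellman_rhs => // s'.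
by rewrite addr0 IH// => [i|h i]; [rewrite addr_ge0|exact: l0].
Qed.

(** * Passage from finite-horizon to all summable multipliers *)

Lemma Lag_partial gam x s a lam n :
  \sum_(t < n) beta ^+ t * Eh s t (fun w => fval (rg gam) a x s w + slack lam a x s w) =
  partial_value (rg gam) a x s n + penalty n lam a x s.
Proof. by rewrite /penalty -big_split; apply: eq_bigr => t _; rewrite EhD mulrDr. Qed.

Lemma Lag_cvg gam x s a lam l : (fun n => penalty n lam a x s) @ \oo --> l ->
  Lag gam x s a lam = value (rg gam) a x s + l.
Proof.
move=> cl; have [C hC] := bdd3_rg gam.
have cv := @cvg_value _ _ hC a x s.
apply: cvg_lim => //; rewrite (_ : (fun n => _) = fun n =>
  partial_value (rg gam) a x s n + penalty n lam a x s); first exact: cvgD.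
by apply/funext => n; rewrite -Lag_partial.
Qed.

Definition mult_weight s lam t : R := beta ^+ t *
  \sum_(h : t.+1.-tuple (S * A)) \sum_(i < I) lam h i * pit s [seq hh.1 | hh <- h].

Lemma size_posthist a s w : size (posthist a s w) = (size w).+1.
Proof. by rewrite size_map size_iota. Qed.

Lemma fst_posthist a s w : [seq hh.1 | hh <- posthist a s w] = s :: w.
Proof.
by elim: w s a => [|s' w IH] s a //; rewrite posthist_cons map_cons IH.
Qed.

Lemma pit_ge0 s h : 0 <= pit s h.
Proof. by case: h => //= s' w; rewrite mulr_ge0 ?ler0n// ltW// pprob_gt0. Qed.

(** A plan selects one post-action history per shock history, injectively, so its expected
    multiplier is a subsum of the total weight. The bound does not depend on the plan. *)
Lemma Eh_posthist_le s t a lam : nonneg_mult lam ->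
  beta ^+ t * Eh s t (fun w => \sum_i lam (posthist a s w) i) <= mult_weight s lam t.
Proof.
move=> l0; rewrite ler_wpM2l ?exprn_ge0 ?(ltW beta_gt0)//.
pose F (h : t.+1.-tuple (S * A)) := \sum_(i < I) lam h i * pit s [seq hh.1 | hh <- h].
have sz (w : t.-tuple S) : size (posthist a s w) == t.+1.
  by rewrite size_posthist size_tuple.
have -> : Eh s t (fun w => \sum_i lam (posthist a s w) i) = \sum_w F (Tuple (sz w)).
  apply: eq_bigr => w _; rewrite mulr_sumr; apply: eq_bigr => i _.
  by rewrite (fst_posthist a s w) /pit eqxx mul1r mulrC.
apply: (ler_sum_inj (F := F)) => [w w' /(congr1 val) /= e|h].
  by apply/val_inj; have := congr1 (map fst) e; rewrite !fst_posthist => -[].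
by apply: sumr_ge0 => i _; rewrite mulr_ge0// pit_ge0.
Qed.

Lemma cont_gap_bounded : exists K : R, 0 <= K /\
  forall i a x s w, `|cont (gfun M i) a x s w - gbar_ M i| <= K.
Proof.
have [C hC] := boolp.choice hg.
exists (\sum_i (`|C i / (1 - beta)| + `|gbar_ M i|)); split=> [|i a x s w].
  by apply: sumr_ge0 => i _; rewrite addr_ge0.
rewrite (bigD1 i)//= -[leLHS]addr0; apply: lerD; last first.
  by apply: sumr_ge0 => j _; rewrite addr_ge0.
apply: le_trans (ler_normB _ _) _; rewrite lerD2r.
exact: le_trans (norm_cont_le (hC i) _ _ _ _) (ler_norm _).
Qed.

Lemma norm_slack_le K lam a x s w : nonneg_mult lam ->
  (forall i a x s w, `|cont (gfun M i) a x s w - gbar_ M i| <= K) ->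
  `|slack lam a x s w| <= K * \sum_i lam (posthist a s w) i.
Proof.
move=> l0 hK; apply: le_trans (ler_norm_sum _ _ _) _; rewrite mulr_sumr.
by apply: ler_sum => i _; rewrite normrM ger0_norm// mulrC ler_wpM2r.
Qed.

Lemma Lag_cutoff T gam x s a lam :
  Lag gam x s a (cutoff T lam) = lagr T gam x s a lam.
Proof.
rewrite lagrE; apply: Lag_cvg; apply: cvg_near_cst; exists T => // n /= Tn.
by apply: (addrI (value (rg gam) a x s)); rewrite -!lagrE lagr_cutoff.
Qed.

Lemma in_Lam_cutoff T s lam : nonneg_mult lam -> in_Lam s (cutoff T lam).
Proof.
move=> l0; split; first exact: cutoff_ge0.
apply: (cvg_series_finite (u := mult_weight s (cutoff T lam)) (T := T)) => t Tt.
rewrite /mult_weight big1 ?mulr0// => h _; apply: big1 => i _.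
by rewrite /cutoff size_tuple ltnNge Tt mul0r.
Qed.

(** The horizon can precede the plan in the quantifiers because the majorant
    [K * mult_weight s lam t] of the penalty terms is free of the plan. *)
Lemma lagr_le_Lag s lam e : in_Lam s lam -> 0 < e -> exists T, forall gam x a,
  lagr T gam x s a lam <= Lag gam x s a lam + e.
Proof.
move=> [l0 cl] e0; have [K [K0 hK]] := cont_gap_bounded.
have cK : cvgn (fun n => \sum_(t < n) K * mult_weight s lam t).
  under eq_fun do rewrite -mulr_sumr.
  by apply: is_cvgM; [exact: is_cvg_cst|exact: cl].
have dom a x t : `|beta ^+ t * Eh s t (slack lam a x s)| <= K * mult_weight s lam t.
  apply: le_trans (ler_wpM2l K0 (Eh_posthist_le s t a l0)).
  rewrite normrM ger0_norm ?exprn_ge0 ?(ltW beta_gt0)// mulrCA.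
  rewrite ler_wpM2l ?exprn_ge0 ?(ltW beta_gt0)// -EhZ.
  apply: le_trans (ler_norm_Eh _ _ _) _; apply: ler_Eh => // w.
  exact: norm_slack_le.
pose v t := K * mult_weight s lam t.
have tail0 : (fun n => rser v - \sum_(t < n) v t) @ \oo --> rser v - rser v.
  by apply: cvgB; [exact: cvg_cst|exact: (cvg_rser (u := v) cK)].
rewrite subrr in tail0.
have [T _ hT] := @cvgr_le _ _ _ _ _ _ tail0 e e0.
exists T => gam x a; have [cp tl] := rser_dominated (dom a x) cK.
have -> := @Lag_cvg gam x s a lam _
  (cvg_rser (u := fun k => beta ^+ k * Eh s k (slack lam a x s)) cp).
rewrite lagrE -addrA lerD2l -lerBlDl.
apply: le_trans (hT T (leqnn T)); apply: le_trans (tl T).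
by rewrite distrC ler_norm.
Qed.

(** Cutoffs of nonnegative multipliers are summable, which gives one inequality; uniform truncation
    of a summable multiplier gives the other. *)
Lemma Dt_dual gam x s : Dt gam x s = (dual gam x s)%:E.
Proof.
have sup_fin T lam : ereal_sup [set (lagr T gam x s a lam)%:E | a in [set a | admissible x s a]]
    = (lagr_sup T gam x s lam)%:E.
  rewrite -ereal_sup_EFin; last 2 first.
  - exact: (has_sup_lagr T gam x s lam).2.
  - exact: (has_sup_lagr T gam x s lam).1.
  by rewrite image_comp.
apply/eqP; rewrite eq_le; apply/andP; split.
  apply/lee_addgt0Pr => e e0.
  have [T /(_ T (leqnn T)) [lam l0 h]] := dual_approx gam x s e0.
  rewrite -EFinD; apply: (@le_trans _ _ (lagr_sup T gam x s lam)%:E); last first.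
    by rewrite lee_fin ltW.
  apply: ereal_inf_lbound; exists (cutoff T lam); first exact: in_Lam_cutoff.
  rewrite -sup_fin; congr (ereal_sup (_ @` _)); apply/funext => a.
  by rewrite Lag_cutoff.
apply: le_ereal_inf_tmp => _ [lam Ll <-].
apply/lee_addgt0Pr => e e0; have [T hT] := lagr_le_Lag Ll e0.
apply: (@le_trans _ _ (lagr_sup T gam x s lam)%:E).
  rewrite lee_fin; apply: dual_le => h i; exact: Ll.1.
rewrite -sup_fin; apply: ge_ereal_sup => _ [a adm <-].
apply: (@le_trans _ _ ((Lag gam x s a lam)%:E + e%:E)%E).
  by rewrite -EFinD lee_fin hT.
by rewrite leeD2r//; apply: ereal_sup_ubound; exists a.
Qed.

(** * Membership of the dual value in the function space *)

Lemma Lconst_ge0 x s : 0 <= Lconst M.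
Proof.
rewrite divr_ge0 ?subr_ge0 ?(ltW beta_lt1)// addr_ge0//.
  exact: le_trans (normr_ge0 _) (norm_le_supn hr x (a_pt M) s).
by apply: sumr_ge0 => i _; exact: le_trans (normr_ge0 _) (norm_le_supn (hg i) x (a_pt M) s).
Qed.

Lemma supB_dual_le x s k :
  (supB dual x s k <= ((1 + k%:R *+ I) * Lconst M)%:E)%E.
Proof.
have L0 := Lconst_ge0 x s.
apply: ge_ereal_sup => _ [g [g0 gk] <-]; rewrite lee_fin.
apply: le_trans (norm_dual_le x s g0) _; rewrite ler_wpM2r// lerD2l.
apply: (@le_trans _ _ (\sum_(i < I) k%:R)); first exact: ler_sum.
by rewrite sumr_const card_ord.
Qed.

Lemma supB_ge0 (F : ('I_I -> R) -> X -> S -> R) x s k : (0 <= supB F x s k)%E.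
Proof.
apply: (@le_trans _ _ (`|F (fun=> 0) x s|)%:E); first by rewrite lee_fin.
by apply: ereal_sup_ubound; exists (fun=> 0) => //; split.
Qed.

Lemma supB_series_le x s :
  (\sum_(k <oo) (((2:R) ^- k.+1)%:E * supB dual x s k.+1) <=
   ((1 + I%:R) * Lconst M / (1 - 3 / 4))%:E)%E.
Proof.
have L0 := Lconst_ge0 x s; have h0 k : (0 <= ((2 : R) ^- k.+1)%:E)%E.
  by rewrite lee_fin invr_ge0 exprn_ge0.
apply: nneseries_le_geometric => [||k|k].
- by rewrite mulr_ge0// addr_ge0.
- by apply/andP; split; lra.
- by rewrite mule_ge0// supB_ge0.
apply: (@le_trans _ _ (((2:R) ^- k.+1)%:E * ((1 + k.+1%:R *+ I) * Lconst M)%:E)%E).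
  by rewrite lee_wpmul2l// supB_dual_le.
rewrite -EFinM lee_fin.
apply: (@le_trans _ _ ((1 + I%:R) * Lconst M * ((2:R) ^- k.+1 * k.+1%:R))); last first.
  by rewrite ler_wpM2l ?half_pow_linear_le// mulr_ge0// addr_ge0.
rewrite [leRHS]mulrCA ler_wpM2l ?invr_ge0 ?exprn_ge0// mulrAC ler_wpM2r//.
by rewrite -mulr_natr mulrDl mul1r lerD ?ler1n// mulrC.
Qed.

Lemma normM_dual : (normM dual < +oo)%E.
Proof.
(* The absolute value makes [C] nonnegative before any state is at hand, as [Lconst_ge0] requires
   one. *)
pose C := (1 + I%:R) * `|Lconst M| / (1 - 3 / 4).
have C0 : 0 <= C by apply: divr_ge0; [rewrite mulr_ge0// addr_ge0|lra].
apply: (@le_lt_trans _ _ (\sum_(s : S) ((2:R) ^- (enum_rank s).+1 * C)%:E)%E); last first.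
  by rewrite sumEFin ltry.
apply: lee_sum => s _; rewrite EFinM lee_wpmul2l ?lee_fin ?invr_ge0 ?exprn_ge0//.
apply: le_trans (esum_pickle_le X C0); apply: le_esum => x _.
rewrite EFinM lee_wpmul2l ?lee_fin ?invr_ge0 ?exprn_ge0//.
by rewrite /C ger0_norm ?(Lconst_ge0 x s)//; exact: supB_series_le.
Qed.

Lemma inN_dual : inN dual.
Proof.
split; [split; last exact: normM_dual|split; [|split; [|split]]].
- by move=> x s k _; exact: le_lt_trans (supB_dual_le x s k) (ltry _).
- by move=> x s g1 g2 t _ _; exact: dual_convex.
- by move=> x s g1 g2 _ _; exact: dual_lipschitz.
- by move=> x s g a _ fa; rewrite -value_rg//; exact: dual_ge_value.
- by move=> x s g g0; exact: dual_le_Lconst.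
Qed.

(** * Measurability of the lottery constraints *)

Lemma actions_map a s w :
  actions a s w = map a [seq (s, take k w) | k <- iota 0 (size w).+1].
Proof. by rewrite /actions -map_comp. Qed.

Lemma fin_det_actions (F : seq A -> R) s w : fin_det (fun a => F (actions a s w)).
Proof.
apply: (@fin_det_map _ _ _ [seq (s, take k w) | k <- iota 0 (size w).+1]) => a b e.
by rewrite !actions_map e.
Qed.

(** The state reached along [w] and the action there read the plan only at prefixes of [w]. *)
Lemma fin_det_fval f x s w : fin_det (fun a => fval f a x s w).
Proof.
exists [seq (s, take k w) | k <- iota 0 (size w).+1] => a b ab.
have {}ab k : (k <= size w)%N -> a (s, take k w) = b (s, take k w).
  by move=> kw; apply: ab; apply: map_f; rewrite mem_iota.
have st pre rest y : pre ++ rest = w ->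
    state_aux a s pre y rest = state_aux b s pre y rest.
  elim: rest pre y => //= s' rest IH pre y e.
  have -> : a (s, pre) = b (s, pre).
    by have := ab (size pre); rewrite -e take_size_cat// size_cat leq_addr; apply.
  by apply: IH; rewrite cat_rcons.
by rewrite /fval /state st// -[w]take_size ab.
Qed.

Definition partial_cont f a x s w n :=
  \sum_(k < n) beta ^+ k * Eh (last s w) k (fun w' => fval f a x s (w ++ w')).

Lemma fin_det_partial_cont f x s w n : fin_det (fun a => partial_cont f a x s w n).
Proof.
apply: fin_det_sum => k; apply: (fin_det2 (fun _ v => beta ^+ k * v) (fin_det_cst _ 0)).
apply: fin_det_sum => w'.
apply: (fin_det2 (fun _ v => pprob (last s w) w' * v) (fin_det_cst _ 0)).
exact: fin_det_fval.
Qed.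

Section Continuation.
Variables (f : X -> A -> S -> R) (C : R).
Hypothesis fC : forall x (b : A) s, `|f x b s| <= C.

Lemma cont_tail a x s w n :
  `|cont f a x s w - partial_cont f a x s w n| <= C / (1 - beta) * beta ^+ n.
Proof.
have term k : `|beta ^+ k * Eh (last s w) k (fun w' => fval f a x s (w ++ w'))| <=
    C * beta ^+ k.
  have bk : 0 <= beta ^+ k by rewrite exprn_ge0// ltW.
  rewrite normrM (ger0_norm bk) mulrC ler_wpM2r//.
  by apply: norm_Eh_le => // w'; exact: fC.
exact: (rser_geometric hbeta term).2.
Qed.

Variables (psi : plan M -> R) (B c : R) (x : X) (s : S) (w : seq S).
Hypothesis psi_fin : fin_det psi.
Hypothesis psiB : forall a, `|psi a| <= B.
Let phi a := psi a * (cont f a x s w - c).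
Let F n a := psi a * (partial_cont f a x s w n - c).
Let e n := B * (C / (1 - beta)) * beta ^+ n.

Let F_fin n : fin_det (F n).
Proof. exact: (fin_det2 (fun u v => u * (v - c)) psi_fin (fin_det_partial_cont _ _ _ _ _)). Qed.

Let F_close n a : `|phi a - F n a| <= e n.
Proof.
rewrite /phi /F -mulrBr normrM /e -mulrA; apply: ler_pM => //.
by rewrite opprB addrA subrK cont_tail.
Qed.

Let e_cvg0 : e @ \oo --> 0.
Proof. by apply: (@cvg_geometric R _ beta); rewrite gtr0_norm. Qed.

Lemma bmeas_cont : bmeas (fun a => psi a * (cont f a x s w - c)).
Proof. exact: bmeas_uniform_lim F_fin F_close e_cvg0. Qed.

Lemma expect_law_cont (P : plan M -> Prop) E (mE : mean P E) :
  expect (law_of_mean mE) (fun a => psi a * (cont f a x s w - c)) =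
  E (fun a => psi a * (cont f a x s w - c)).
Proof. exact: expect_law_lim F_fin F_close e_cvg0 _ _ mE. Qed.

End Continuation.

Lemma bmeas_value gam x s : bmeas (fun a => value (rg gam) a x s).
Proof.
have [C hC] := bdd3_rg gam.
(* A value is the continuation at the empty history, with constant factor 1 and threshold 0. *)
have := bmeas_cont hC 0 x s [::] (fin_det_cst M 1) (fun=> lexx _).
by under eq_fun do rewrite mul1r subr0.
Qed.

Lemma expect_law_value gam x s (P : plan M -> Prop) E (mE : mean P E) :
  expect (law_of_mean mE) (fun a => value (rg gam) a x s) = E (fun a => value (rg gam) a x s).
Proof.
have [C hC] := bdd3_rg gam.
have := expect_law_cont hC 0 x s [::] (fin_det_cst M 1) (fun=> lexx _) mE.
by under eq_fun do rewrite mul1r subr0.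
Qed.

Definition constraint x s w (at_ : seq A) i a :=
  (actions a s w == at_)%:R * (cont (gfun M i) a x s w - gbar_ M i).

Let norm_bool_le1 (b : bool) : `|b%:R| <= (1 : R).
Proof. by case: b; rewrite ?normr0 ?normr1. Qed.

Lemma bmeas_constraint x s w at_ i : bmeas (constraint x s w at_ i).
Proof.
have [C hC] := hg i; apply: (bmeas_cont hC) => [|a]; last exact: norm_bool_le1.
exact: (fin_det_actions (fun ys => (ys == at_)%:R)).
Qed.

Lemma expect_law_constraint x s w at_ i (P : plan M -> Prop) E (mE : mean P E) :
  expect (law_of_mean mE) (constraint x s w at_ i) = E (constraint x s w at_ i).
Proof.
have [C hC] := hg i; apply: (expect_law_cont hC) => [|a]; last exact: norm_bool_le1.
exact: (fin_det_actions (fun ys => (ys == at_)%:R)).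
Qed.

(* Shock histories are enumerated through [unpickle]; codes that do not denote a
   history impose no condition. *)
Definition admissible_at x s (o : option (seq S)) : set (plan M) :=
  [set a | if o is Some w then 0 <= fval (pfun M) a x s w else True].

Lemma admissible_at_clopen x s o : clopen (admissible_at x s o).
Proof.
case: o => [w|]; last by exists [::].
have [hs h] := fin_det_fval (pfun M) x s w.
by exists hs => a b ab; rewrite /admissible_at /= (h a b ab).
Qed.

Lemma admissible_sub_at x s o a : admissible x s a -> admissible_at x s o a.
Proof. by case: o => // w; exact. Qed.

Lemma admissibleE_bigcap x s : [set a : plan M | admissible x s a] =
  \bigcap_n admissible_at x s (unpickle n).
Proof.
apply/seteqP; split=> a adm; first by move=> n _; exact: admissible_sub_at.
by move=> w; have := adm (pickle w) Logic.I; rewrite pickleK; exact.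
Qed.

Local Notation PlanM := (g_sigma_algebraType (@cyl R M)).

Lemma measurable_admissible x s : measurable [set a : PlanM | admissible x s a].
Proof.
rewrite admissibleE_bigcap; apply: bigcapT_measurable => n.
exact: (measurable_clopen_set (admissible_at_clopen x s _)).
Qed.

(** The mean gives 1 to the admissibility condition at each single history, a clopen set. Countable
    additivity of the law, which [E] itself may lack, combines these conditions. *)
Lemma law_admissible x s E (mE : mean [set a : plan M | admissible x s a] E) :
  law_of_mean mE [set a : PlanM | admissible x s a] = 1%E.
Proof.
pose Pr : probability PlanM R := law_of_mean mE.
have madm := measurable_admissible x s.
have mat o := measurable_clopen_set (admissible_at_clopen x s o).
have at1 o : Pr (~` admissible_at x s o) = 0%E.
  rewrite probability_setC// /= law_clopen; last exact: admissible_at_clopen.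
  rewrite (_ : E _ = 1) ?subee//; apply/eqP; rewrite eq_le -(mean_cst mE 1).
  apply/andP; split; apply: (mean_le mE); try exact: bounded_indic; try exact: bounded_cst.
    by move=> a _; rewrite indicE lern1 leq_b1.
  by move=> a adm; rewrite indicE mem_set//; exact: admissible_sub_at.
have nadm : Pr (~` [set a : PlanM | admissible x s a]) = 0%E.
  apply: measure_negligible; first exact: measurableC.
  rewrite admissibleE_bigcap setC_bigcap; apply: negligible_bigcup => n.
  by apply/negligibleP; [exact: (measurableC (mat _))|exact: at1].
have := probability_setC Pr (measurableC madm).
by rewrite setCK nadm sube0.
Qed.

Lemma posthist_zip a s w : posthist a s w = zip (s :: w) (actions a s w).
Proof.
rewrite -[LHS]zip_unzip; congr zip; first exact: fst_posthist.
by rewrite /unzip2 -map_comp.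
Qed.

Lemma size_actions a s w : size (actions a s w) = (size w).+1.
Proof. by rewrite size_map size_iota. Qed.

(** Exactly one action tuple matches the plan, so summing over all tuples with indicators exposes
    the lottery constraints. *)
Lemma slackE t (w : t.-tuple S) lam a x s : slack lam a x s w =
  \sum_i \sum_(at_ : t.+1.-tuple A) lam (zip (s :: w) at_) i * constraint x s w at_ i a.
Proof.
apply: eq_bigr => i _.
have sz : size (actions a s w) == t.+1 by rewrite size_actions size_tuple.
rewrite (bigD1 (Tuple sz))//= big1 ?addr0; first by rewrite /constraint eqxx mul1r posthist_zip.
move=> ys nys; rewrite /constraint; case: eqP; last by rewrite mul0r mulr0.
by move=> e; case/eqP: nys; apply/val_inj.
Qed.

Lemma penaltyE T lam a x s : penalty T lam a x s =
  \sum_(t < T) \sum_(w : t.-tuple S) \sum_i \sum_(at_ : t.+1.-tuple A)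
    (beta ^+ t * (pprob s w * lam (zip (s :: w) at_) i)) * constraint x s w at_ i a.
Proof.
apply: eq_bigr => t _; rewrite mulr_sumr; apply: eq_bigr => w _.
rewrite slackE !mulr_sumr; apply: eq_bigr => i _.
by rewrite !mulr_sumr; apply: eq_bigr => ys _; rewrite !mulrA.
Qed.

(** * Weak duality for lotteries *)

Section WeakDuality.
Variables (Pr : probability PlanM R) (x : X) (s : S).
Hypothesis hPr : lot_feas x s Pr.

Lemma expect_sum_ge0 (J : finType) (F : J -> plan M -> R) :
  (forall j, bmeas (F j) /\ 0 <= expect Pr (F j)) ->
  bmeas (fun a => \sum_j F j a) /\ 0 <= expect Pr (fun a => \sum_j F j a).
Proof.
move=> h; have b j := (h j).1; split; first exact: bmeas_sum.
by rewrite expect_sum//; apply: sumr_ge0 => j _; exact: (h j).2.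
Qed.

(** By [penaltyE] the penalty is a nonnegative combination of constraints, each with nonnegative
    expectation under a feasible lottery. *)
Lemma expect_penalty_ge0 T lam : nonneg_mult lam ->
  bmeas (fun a => penalty T lam a x s) /\ 0 <= expect Pr (fun a => penalty T lam a x s).
Proof.
move=> l0; under eq_fun do rewrite penaltyE.
apply: expect_sum_ge0 => t; apply: expect_sum_ge0 => w; apply: expect_sum_ge0 => i.
apply: expect_sum_ge0 => ys; have bc := bmeas_constraint x s w ys i.
split; first exact: bmeasZ; rewrite expectZ//.
apply: mulr_ge0; first by rewrite !mulr_ge0 ?exprn_ge0 ?(ltW beta_gt0)// ltW// pprob_gt0.
by have := hPr.2 t w ys i; rewrite (integral_bmeas Pr bc) lee_fin.
Qed.

(** Outside the admissible plans, a null set, adding [B + |c|] to [c] dominates [phi] without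
    changing the expectation. *)
Lemma expect_le_admissible (phi : plan M -> R) (c : R) : bmeas phi ->
  (forall a, admissible x s a -> phi a <= c) -> expect Pr phi <= c.
Proof.
move=> bphi hc; have [B hB] := bphi.2; have madm := measurable_admissible x s.
pose N : set PlanM := ~` [set a | admissible x s a].
have mN : measurable N by exact: measurableC.
have bN := bmeasZ (B + `|c|) (bmeas_indic mN).
have N0 : expect Pr (\1_N) = 0.
  by rewrite expect_indic// probability_setC// hPr.1 subee.
have -> : c = expect Pr (fun a => c + (B + `|c|) * \1_N a).
  rewrite expectD ?expect_cst ?expectZ ?N0 ?mulr0 ?addr0//; try exact: bmeas_indic.
  exact: bmeas_cst.
apply: ler_expect => // [|a]; first by apply: bmeasD => //; exact: bmeas_cst.
rewrite indicE; have [adm|nadm] := pselect (admissible x s a).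
  by rewrite memNset ?mulr0 ?addr0; [exact: hc|exact].
rewrite mem_set// mulr1 addrCA; apply: le_trans (le_trans (ler_norm _) (hB a)) _.
by rewrite lerDl -lerBlDl sub0r -normrN ler_norm.
Qed.

Lemma weak_duality gam : nonneg gam -> expect Pr (fun a => value (rg gam) a x s) <= dual gam x s.
Proof.
move=> g0; apply: dual_ge => // T lam l0; have bv := bmeas_value gam x s.
have [bp p0] := expect_penalty_ge0 T l0.
apply: (@le_trans _ _ (expect Pr (fun a => value (rg gam) a x s + penalty T lam a x s))).
  by rewrite expectD// lerDl.
apply: expect_le_admissible; first exact: bmeasD.
by move=> a adm; rewrite -lagrE; exact: lagr_sup_ub.
Qed.

End WeakDuality.

(** * Existence of an optimal lottery *)

Section StrongDuality.
Variables (gam : 'I_I -> R) (x : X) (s : S).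

Lemma constraint_ge0 a w at_ i : feasible x s a -> 0 <= constraint x s w at_ i a.
Proof. by move=> fa; rewrite mulr_ge0// subr_ge0; exact: fa.2. Qed.

(** [mean_nonneg] is applied to the objective gap together with the constraints of the first [n]
    periods. Nonnegative weights on these functions amount to a multiplier, for which a nearly
    maximising plan has the required sign. *)
Lemma approx_lottery n (e : R) : 0 < e -> exists2 m, mean [set a | admissible x s a] m &
  dual gam x s - e <= m (fun a => value (rg gam) a x s) /\
  forall (t : 'I_n) (w : t.-tuple S) (at_ : t.+1.-tuple A) i,
    - e <= m (constraint x s w at_ i).
Proof.
move=> e0; pose K (t : 'I_n) := (t.-tuple S * t.+1.-tuple A * 'I_I)%type.
pose J : finType := {t : 'I_n & K t}.
pose jw (j : J) : (tag j).-tuple S := (tagged j).1.1.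
pose ja (j : J) : (tag j).+1.-tuple A := (tagged j).1.2.
pose ji (j : J) : 'I_I := (tagged j).2.
pose e2 := e / 2; have e20 : 0 < e2 by rewrite divr_gt0.
pose obj a := value (rg gam) a x s - (dual gam x s - e2).
pose c (j : unit + J) : plan M -> R := match j with
  | inl _ => obj
  | inr j => constraint x s (jw j) (ja j) (ji j)
  end.
have bobj : bounded obj.
  have := bmeas_lin 1 1 (bmeas_value gam x s) (bmeas_cst M (- (dual gam x s - e2))).
  by under eq_fun do rewrite !mul1r; case.
have bc j : bounded (c j) by case: j => [_|j] //; exact: (bmeas_constraint _ _ _ _ _).2.
have hy (y : unit + J -> R) : (forall j, 0 <= y j) ->
    exists2 a, admissible x s a & 0 <= \sum_j y j * c j a.
  move=> y0; have sumE a : \sum_j y j * c j a =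
      y (inl tt) * obj a + \sum_(j : J) y (inr j) * c (inr j) a.
    by rewrite big_sumType /= (bigD1 tt)//= big1 ?addr0// => -[].
  (* With no weight on the objective, a feasible plan makes every remaining term nonnegative. *)
  have [yN|yN] := eqVneq (y (inl tt)) 0.
    have [a fa] := hstand x s; exists a; first exact: fa.1.
    rewrite sumE yN mul0r add0r; apply: sumr_ge0 => j _.
    by rewrite mulr_ge0//; exact: constraint_ge0.
  have yp : 0 < y (inl tt) by rewrite lt_neqAle eq_sym yN y0.
  (* Division by the objective weight normalises it to 1; the other factors undo the discounting and
     probability in the penalty. *)
  pose v j := y (inr j) / (y (inl tt) * (beta ^+ tag j * pprob s (jw j))).
  have v0 j : 0 <= v j.
    by rewrite divr_ge0 ?mulr_ge0 ?exprn_ge0 ?(ltW beta_gt0) ?(ltW yp)// ltW// pprob_gt0.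
  pose lam h i := \sum_(j : J) ((zip (s :: jw j) (ja j) == h) && (ji j == i))%:R * v j.
  have l0 : nonneg_mult lam by move=> h i; apply: sumr_ge0 => j _; rewrite mulr_ge0.
  have [a adm ha] := lagr_sup_approx n gam x s lam e20.
  exists a => //.
  have pen : y (inl tt) * penalty n lam a x s = \sum_(j : J) y (inr j) * c (inr j) a.
    pose G t w i := beta ^+ t * (pprob s w * (cont (gfun M i) a x s w - gbar_ M i)).
    have penJ : penalty n lam a x s = \sum_(j : J) v j *
        \sum_(t < n) \sum_(w : t.-tuple S) \sum_i
          ((zip (s :: jw j) (ja j) == posthist a s w) && (ji j == i))%:R * G t w i.
      under [RHS]eq_bigr do rewrite mulr_sumr.
      rewrite exchange_big; apply: eq_bigr => t _ /=.
      under [RHS]eq_bigr do rewrite mulr_sumr.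
      rewrite exchange_big mulr_sumr; apply: eq_bigr => w _ /=.
      under [RHS]eq_bigr do rewrite mulr_sumr.
      rewrite exchange_big !mulr_sumr; apply: eq_bigr => i _ /=.
      rewrite /lam mulr_suml !mulr_sumr; apply: eq_bigr => j _.
      by rewrite /G; ring.
    rewrite penJ mulr_sumr; apply: eq_bigr => j _.
    have -> : \sum_(t < n) \sum_(w : t.-tuple S) \sum_i
        ((zip (s :: jw j) (ja j) == posthist a s w) && (ji j == i))%:R * G t w i =
        (actions a s (jw j) == ja j)%:R * G (tag j) (jw j) (ji j).
      have zipE w : (zip (s :: jw j) (ja j) == posthist a s w) =
          (w == jw j :> seq S) && (actions a s (jw j) == ja j).
        have szj : size (s :: jw j) = size (ja j) by rewrite /= !size_tuple.
        apply/eqP/andP => [e'|[/eqP -> /eqP e']]; last by rewrite posthist_zip e'.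
        have wE : w = jw j.
          have := congr1 (map fst) e'.
          by rewrite fst_posthist -/(unzip1 _) unzip1_zip ?szj// => -[].
        split; first exact/eqP.
        rewrite -wE; have := congr1 (map snd) e'.
        rewrite posthist_zip -/(unzip2 _) -/(unzip2 _) !unzip2_zip ?szj//; first by move=> ->.
        by rewrite size_actions.
      rewrite (bigD1 (tag j))//= (bigD1 (jw j))//= (bigD1 (ji j))//= zipE !eqxx /= andbT.
      rewrite !big1 ?addr0//.
      - move=> t nt; apply: big1 => w _; apply: big1 => i _; rewrite zipE.
        case: eqP => [/(congr1 size)|]; rewrite ?mul0r// !size_tuple => tE.
        by case/eqP: nt; apply/val_inj.
      - move=> w nw; apply: big1 => i _; rewrite zipE.
        case: eqP => [wE|]; rewrite ?mul0r//.
        by case/eqP: nw; apply/val_inj.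
      - by move=> i ni; rewrite [ji j == i]eq_sym (negbTE ni) andbF mul0r.
    rewrite /G /v /c /constraint; set pw := pprob s (jw j); set bt := beta ^+ tag j.
    have pw0 : pw != 0 by rewrite gt_eqF// pprob_gt0.
    have bt0 : bt != 0 by rewrite gt_eqF// exprn_gt0.
    by field; rewrite pw0 bt0 yN.
  rewrite sumE -pen -mulrDr mulr_ge0//.
  have := dual_le n gam x s l0; move: ha; rewrite lagrE /obj; lra.
have [m mm hm] := mean_nonneg bc hy e20.
exists m => //; split.
  have bv := (bmeas_value gam x s).2.
  have := hm (inl tt); rewrite /c /obj.
  have -> : (fun a => value (rg gam) a x s - (dual gam x s - e2)) =
      fun a => 1 * value (rg gam) a x s + (- (dual gam x s - e2)) * 1.
    by apply/funext => a; rewrite mul1r mulr1.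
  rewrite (mean_lin mm 1 _ bv (bounded_cst _ 1)) (mean_cst mm) /e2; lra.
move=> t w at_ i; apply: le_trans (hm (inr (Tagged K (w, at_, i)))).
by rewrite lerN2 /e2; lra.
Qed.

(** The approximate lotteries have horizon [n] and error [1 / (n + 1)]. Each fixed constraint is
    covered from some [n] on, so the ultralimit satisfies it exactly, and the law inherits this. *)
Lemma strong_duality : exists2 Pr, lot_feas x s Pr &
  dual gam x s <= expect Pr (fun a => value (rg gam) a x s).
Proof.
have /boolp.choice[m hm] : forall n : nat, exists m, mean [set a | admissible x s a] m /\
    (dual gam x s - n.+1%:R^-1 <= m (fun a => value (rg gam) a x s) /\
    forall (t : 'I_n) (w : t.-tuple S) (at_ : t.+1.-tuple A) i,
      - n.+1%:R^-1 <= m (constraint x s w at_ i)).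
  move=> n; have [|m mm h] := @approx_lottery n (n.+1%:R^-1); first by rewrite invr_gt0.
  by exists m.
have [E mE hE] := mean_ultralimit (fun n => (hm n).1).
have inv_small (e : R) : 0 < e -> \forall n \near \oo, n.+1%:R^-1 <= e.
  by move=> e0; near=> n; apply: ltW; near: n; exact: near_infty_natSinv_lt (PosNum e0).
exists (law_of_mean mE : probability PlanM R); last first.
  rewrite expect_law_value; apply: hE; first exact: (bmeas_value gam x s).2.
  move=> e e0; near=> n; apply: le_trans (hm n).2.1.
  by rewrite lerB//; near: n; exact: inv_small.
split; first exact: law_admissible.
move=> t w ys i; have bc := bmeas_constraint x s w ys i.
rewrite (integral_bmeas (law_of_mean mE) bc) lee_fin expect_law_constraint.
apply: hE; first exact: bc.2.
move=> e e0; near=> n; have tn : (t < n)%N by near: n; exact: nbhs_infty_gt.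
rewrite sub0r; apply: le_trans ((hm n).2.2 (Ordinal tn) w ys i).
by rewrite lerN2; near: n; exact: inv_small.
Unshelve. all: by end_near. Qed.

End StrongDuality.

Lemma lottery_max_dual gam x s : nonneg gam -> lottery_max gam x s (dual gam x s)%:E.
Proof.
move=> g0; have objE Pr : lot_obj gam x s Pr = (expect Pr (fun a => value (rg gam) a x s))%:E.
  exact: (integral_bmeas Pr (bmeas_value gam x s)).
split=> [|Pr hPr]; last by rewrite objE lee_fin weak_duality.
have [Pr hPr hd] := strong_duality gam x s.
exists Pr; split=> //; rewrite objE; congr (_%:E); apply/eqP.
by rewrite eq_le hd weak_duality.
Qed.

End Model.

Theorem theorem4p7 (R : realType) (M : model R)
  (hpi : forall s s' : St M, 0 < trans_ M s s')
  (hstoch : forall s : St M, \sum_(s' : St M) trans_ M s s' = 1)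
  (hr : bdd3 (rfun M)) (hg : forall i, bdd3 (gfun M i))
  (hbeta : 0 < beta_ M < 1)
  (hstand : forall (x0 : Xs M) (s0 : St M), exists a, feasible x0 s0 a) :
  (forall (g : 'I_(nI M) -> R) (x0 : Xs M) (s0 : St M),
      nonneg g -> lottery_max g x0 s0 (Dt g x0 s0)) /\
  exists Dr : ('I_(nI M) -> R) -> Xs M -> St M -> R,
    (forall g x s, nonneg g -> Dt g x s = (Dr g x s)%:E) /\
    inN Dr /\ bellman Dr /\
    (forall F, inN F -> bellman F -> forall g x s, nonneg g -> F g x s <= Dr g x s).

Proof.
split=> [g x0 s0 g0|].
  by rewrite Dt_dual//; exact: lottery_max_dual.
exists (@dual R M); split; first by move=> g x s _; exact: Dt_dual.
split; first exact: inN_dual.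
split; first exact: bellman_dual.
by move=> F NF bF g x s g0; exact: bellman_le_dual.
Qed.
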